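(* Let $S$ be a connected orientable smooth surface and let $\phi \colon S \to \mathbb{R}^3$ be an immersion with nowhere vanishing support function such that its polar dual $\psi \colon S \to \mathbb{R}^3$ is also an immersion. (1) If $\xi \colon S \to \mathbb{R}^3$ is an isometric infinitesimal deformation of $M = \phi(S)$, then its translation vector field $\tau$ is an isogauss infinitesimal deformation of $N = \psi(S)$. (2) Conversely, if $\tau$ is an isogauss infinitesimal deformation of $N$ and $H^1(S) = 0$, then there is an isometric infinitesimal deformation $\xi$ of $M$ such that $\tau$ is its translation vector field. In both cases, $\xi$ is induced by a Killing field on $\mathbb{R}^3$ (i.e. $\xi = a\times\phi + b$ for some $a,b\in\mathbb{R}^3$) if and only if $\tau$ is constant.
   Context: Let $\nu \colon S\to\mathbb{R}^3$ be a smooth unit normal field of the immersion $\phi$ and $h = \langle\nu,\phi\rangle$ its support function. If $h$ vanishes nowhere, the polar dual of $\phi$ is $\psi = \nu/h \colon S\to\mathbb{R}^3$. An infinitesimal deformation of an immersion is a smooth map from $S$ to $\mathbb{R}^3$. A deformation $\xi$ of $\phi$ is isometric if the metrics $g_t$ induced on $S$ by $\phi+t\xi$ satisfy $\frac{d}{dt}\big|_{t=0}g_t=0$. For every isometric $\xi$ there is a unique pair of maps $\eta,\tau \colon S\to\mathbb{R}^3$ such that $\xi = \eta\times\phi+\tau$, $d\xi = \eta\times d\phi$, $d\tau = \phi\times d\eta$; $\eta$ is the rotation vector field and $\tau$ the translation vector field of $\xi$. A deformation $\tau$ of the immersion $\psi$ is isogauss if the maps $\psi_t = \psi+t\tau$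 preserve tangent planes up to parallelism (equivalently $d\tau(T_xS)\subset d\psi(T_xS)$ for all $x\in S$) and the Gauss curvature $K_t(x)$ of $\psi_t$ at $x$ satisfies $\frac{d}{dt}\big|_{t=0}K_t(x)=0$ for all $x\in S$. $H^1(S)$ is the first (de Rham) cohomology. *)

(* Defs.v *)
From HB Require Import structures.
From mathcomp Require Export all_boot all_order all_algebra.
From mathcomp Require Export all_classical all_reals all_analysis.

Set Implicit Arguments.
Unset Strict Implicit.
Unset Printing Implicit Defensive.

Import Order.TTheory GRing.Theory Num.Theory.
Import numFieldNormedType.Exports.

Local Open Scope classical_set_scope.
Local Open Scope ring_scope.

(** Euclidean 3-space. The norm [`|u|] that the library puts on row vectors
    is the sup norm, so the Euclidean norm is defined separately. *)

Definition dotv (R : realType) n (u v : 'rV[R]_n) : R :=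
  \sum_(i < n) u 0 i * v 0 i.

Definition enorm (R : realType) n (u : 'rV[R]_n) : R := Num.sqrt (dotv u u).

Definition crossv (R : realType) (u v : 'rV[R]_3) : 'rV[R]_3 :=
  \row_(k < 3) (u 0 (k + 1) * v 0 (k + 2) - u 0 (k + 2) * v 0 (k + 1)).

(** [f] is of class C^oo on the open set [U]: all its iterated directional
    derivatives, [f] included, are differentiable at all points of [U]. *)
Definition smooth_on (R : realType) (W : normedModType R)
    (U : set 'rV[R]_2) (f : 'rV[R]_2 -> W) : Prop :=
  forall (vs : seq 'rV[R]_2) (u : 'rV[R]_2), U u ->
    differentiable (foldr (fun v g => 'D_v g) f vs) u.

(** A chart is a homeomorphism [coord] from the open set [dom] onto the open
    set [cod] of R^2, with inverse [param]; the values of these two total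
    functions outside [dom] and [cod] are irrelevant. *)
Record chart (R : realType) (S : topologicalType) := Chart {
  dom : set S;
  cod : set 'rV[R]_2;
  coord : S -> 'rV[R]_2;
  param : 'rV[R]_2 -> S;
  dom_open : open dom;
  cod_open : open cod;
  coord_cod : forall p, dom p -> cod (coord p);
  param_dom : forall u, cod u -> dom (param u);
  coordK : forall p, dom p -> param (coord p) = p;
  paramK : forall u, cod u -> coord (param u) = u;
  coord_continuous : forall p, dom p -> {for p, continuous coord};
  param_continuous : forall u, cod u -> {for u, continuous param}
}.

Definition transition (R : realType) (S : topologicalType) (c c' : chart R S)
  : 'rV[R]_2 -> 'rV[R]_2 := coord c' \o param c.

Definition transition_dom (R : realType) (S : topologicalType)
    (c c' : chart R S) : set 'rV[R]_2 :=
  [set u | cod c u /\ dom c' (param c u)].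

Definition compatible (R : realType) (S : topologicalType) (c c' : chart R S)
  : Prop :=
  smooth_on (transition_dom c c') (transition c c') /\
  smooth_on (transition_dom c' c) (transition c' c).

Definition covering (R : realType) (S : topologicalType)
    (A : set (chart R S)) : Prop :=
  forall p : S, exists2 c, A c & dom c p.

(** The atlas is not required to be maximal. *)
Record surface (R : realType) := Surface {
  carrier :> topologicalType;
  surface_hausdorff : hausdorff_space carrier;
  surface_second_countable : @second_countable carrier;
  atlas : set (chart R carrier);
  atlas_covering : covering atlas;
  atlas_compatible : forall c c', atlas c -> atlas c' -> compatible c c'
}.

Definition orientable (R : realType) (S : surface R) : Prop :=
  exists A : set (chart R S),
    [/\ covering A,
        forall c c', A c -> atlas c' -> compatible c c' &
        forall c c', A c -> A c' ->
          forall u, transition_dom c c' u ->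
            0 < \det (jacobian (transition c c') u)].

Definition smooth_map (R : realType) (S : surface R) (W : normedModType R)
    (f : S -> W) : Prop :=
  forall c, atlas c -> smooth_on (cod c) (f \o param c).

(** The differential of [f] at [p], applied to the tangent vector at [p] whose
    coordinates in the chart [c] are [v]; meaningful when [dom c p]. *)
Definition dmap (R : realType) (S : surface R) (W : normedModType R)
    (c : chart R S) (f : S -> W) (p : S) (v : 'rV[R]_2) : W :=
  'D_v (f \o param c) (coord c p).

(** A quantifier over all tangent vectors [(c, p, v)] of [S]. *)
Definition for_tangent (R : realType) (S : surface R)
    (P : chart R S -> S -> 'rV[R]_2 -> Prop) : Prop :=
  forall c p v, atlas c -> dom c p -> P c p v.

(** A differential 1-form is given by its coefficients in the charts:
    [w c p] is [(a_0, a_1)] when the form is [a_0 dx_0 + a_1 dx_1] at [p] in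
    the coordinates [(x_0, x_1)] of [c]. *)
Definition one_form (R : realType) (S : surface R)
    (w : chart R S -> S -> 'rV[R]_2) : Prop :=
  (forall c, atlas c -> smooth_on (cod c) (w c \o param c)) /\
  (forall c c' p v, atlas c -> atlas c' -> dom c p -> dom c' p ->
     dotv (w c p) v = dotv (w c' p) ('D_v (transition c c') (coord c p))).

Definition closed_form (R : realType) (S : surface R)
    (w : chart R S -> S -> 'rV[R]_2) : Prop :=
  forall c p, atlas c -> dom c p ->
    dmap c (w c) p (delta_mx 0 0) 0 1 = dmap c (w c) p (delta_mx 0 1) 0 0.

Definition exact_form (R : realType) (S : surface R)
    (w : chart R S -> S -> 'rV[R]_2) : Prop :=
  exists2 f : S -> R^o, smooth_map f &
    for_tangent (fun c p v => dmap c f p v = dotv (w c p) v).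

(** H^1(S) = 0 *)
Definition H1_trivial (R : realType) (S : surface R) : Prop :=
  forall w : chart R S -> S -> 'rV[R]_2,
    one_form w -> closed_form w -> exact_form w.

Section ImmersedSurfaces.
Variables (R : realType) (S : surface R).
Implicit Types f phi psi nu xi eta tau : S -> 'rV[R]_3.

Definition immersion f : Prop :=
  smooth_map f /\
  forall c p, atlas c -> dom c p -> injective (dmap c f p).

Definition unit_normal phi nu : Prop :=
  [/\ smooth_map nu,
      forall p, enorm (nu p) = 1 &
      for_tangent (fun c p v => dotv (nu p) (dmap c phi p v) = 0)].

Definition support_function phi nu (p : S) : R := dotv (nu p) (phi p).

Definition polar_dual phi nu (p : S) : 'rV[R]_3 :=
  (support_function phi nu p)^-1 *: nu p.

Definition deform f xi (t : R) (p : S) : 'rV[R]_3 := f p + t *: xi p.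

Definition induced_metric f (c : chart R S) (p : S) (v w : 'rV[R]_2) : R :=
  dotv (dmap c f p v) (dmap c f p w).

Definition isometric phi xi : Prop :=
  smooth_map xi /\
  for_tangent (fun c p v => forall w : 'rV[R]_2,
    is_derive (0 : R^o) (1 : R^o)
      (fun t : R^o => induced_metric (deform phi xi t) c p v w : R^o) 0).

Definition rotation_translation phi xi eta tau : Prop :=
  [/\ smooth_map eta, smooth_map tau,
      forall p, xi p = crossv (eta p) (phi p) + tau p,
      for_tangent (fun c p v =>
        dmap c xi p v = crossv (eta p) (dmap c phi p v)) &
      for_tangent (fun c p v =>
        dmap c tau p v = crossv (phi p) (dmap c eta p v))].

Definition translation_field phi xi tau : Prop :=
  exists eta, rotation_translation phi xi eta tau.

Definition coord_partial (c : chart R S) f (i : 'I_2)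
  : 'rV[R]_2 -> 'rV[R]_3 := 'D_(delta_mx 0 i) (f \o param c).

Definition chart_normal (c : chart R S) f (p : S) : 'rV[R]_3 :=
  let n := crossv (coord_partial c f 0 (coord c p))
                  (coord_partial c f 1 (coord c p)) in
  (enorm n)^-1 *: n.

Definition first_fundamental (c : chart R S) f (p : S) : 'M[R]_2 :=
  \matrix_(i, j) dotv (coord_partial c f i (coord c p))
                      (coord_partial c f j (coord c p)).

Definition second_fundamental (c : chart R S) f (p : S) : 'M[R]_2 :=
  \matrix_(i, j) dotv ('D_(delta_mx 0 i) (coord_partial c f j) (coord c p))
                      (chart_normal c f p).

(** Independent of the chart [c] around [p]; meaningful when [f] is an
    immersion near [p]. *)
Definition gauss_curvature (c : chart R S) f (p : S) : R :=
  \det (second_fundamental c f p) / \det (first_fundamental c f p).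

(** For [p] fixed and [psi] an immersion, [deform psi tau t] is an immersion
    near [p] as soon as [t] is close to 0. *)
Definition isogauss psi tau : Prop :=
  [/\ smooth_map tau,
      forall c p, atlas c -> dom c p ->
        range (dmap c tau p) `<=` range (dmap c psi p) &
      forall c p, atlas c -> dom c p ->
        is_derive (0 : R^o) (1 : R^o)
          (fun t : R^o => gauss_curvature c (deform psi tau t) p : R^o) 0].

Definition induced_by_killing phi xi : Prop :=
  exists a b : 'rV[R]_3, forall p, xi p = crossv a (phi p) + b.

Definition constant_field tau : Prop :=
  exists b : 'rV[R]_3, forall p, tau p = b.

End ImmersedSurfaces.

(* Main.v *)
(** Write psi for the polar dual. From <psi, phi> = 1 and <psi, dphi> = 0 one
    gets <dpsi, phi> = 0, so phi is normal to psi. If a map F satisfies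
    <dF, phi> = 0, its Gauss curvature in a chart is
      <phi, phi_0 x phi_1> / (|phi|^2 <F_0 x F_1, phi>),
    so a deformation tau of psi is isogauss iff <dtau, phi> = 0 and
    <tau_0 x psi_1 + psi_0 x tau_1, phi> = 0.
    An isometric xi determines eta pointwise by dxi = eta x dphi. Equality of
    the mixed partial derivatives of xi makes deta tangent to phi, that is
    <deta, psi> = 0. For tau = xi - eta x phi one has dtau = phi x deta, and
    the condition on tau_0 x psi_1 + psi_0 x tau_1 becomes
    <eta_0, psi_1> = <eta_1, psi_0>, which follows by differentiating
    <deta, psi> = 0.
    Conversely dtau = phi x deta and <deta, psi> = 0 force
    deta = dtau x psi, and this vector-valued form is closed exactly when
    tau_0 x psi_1 + psi_0 x tau_1 = 0; a primitive eta gives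
    xi = eta x phi + tau. Finally tau is constant iff deta = 0. *)

Require Import Defs.
From mathcomp Require Import ring lra.

Set Implicit Arguments.
Unset Strict Implicit.
Unset Printing Implicit Defensive.

Import Order.TTheory GRing.Theory Num.Theory.
Import numFieldNormedType.Exports.

Local Open Scope classical_set_scope.
Local Open Scope ring_scope.

(** * Vector algebra in R^3 *)

Section VectorAlgebra.
Variable R : realType.
Implicit Types u v w x y : 'rV[R]_3.

Lemma ord3P (P : 'I_3 -> Prop) : P 0 -> P 1 -> P 2 -> forall i, P i.
Proof.
move=> P0 P1 P2 [[|[|[|//]]] lt_i].
- by rewrite (_ : Ordinal _ = 0)//; exact/val_inj.
- by rewrite (_ : Ordinal _ = 1)//; exact/val_inj.
- by rewrite (_ : Ordinal _ = 2)//; exact/val_inj.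
Qed.

Lemma row3P u v :
  u 0 0 = v 0 0 -> u 0 1 = v 0 1 -> u 0 2 = v 0 2 -> u = v.
Proof. by move=> h0 h1 h2; apply/rowP; exact: ord3P. Qed.

Lemma dotv3E u v :
  dotv u v = u 0 0 * v 0 0 + u 0 1 * v 0 1 + u 0 2 * v 0 2.
Proof.
rewrite /dotv !big_ord_recr big_ord0 /= add0r.
by congr (u 0 _ * v 0 _ + u 0 _ * v 0 _ + u 0 _ * v 0 _); exact/val_inj.
Qed.

Lemma crossv0E u v : crossv u v 0 0 = u 0 1 * v 0 2 - u 0 2 * v 0 1.
Proof.
by rewrite !mxE; congr (u 0 _ * v 0 _ - u 0 _ * v 0 _); exact/val_inj.
Qed.

Lemma crossv1E u v : crossv u v 0 1 = u 0 2 * v 0 0 - u 0 0 * v 0 2.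
Proof.
by rewrite !mxE; congr (u 0 _ * v 0 _ - u 0 _ * v 0 _); exact/val_inj.
Qed.

Lemma crossv2E u v : crossv u v 0 2 = u 0 0 * v 0 1 - u 0 1 * v 0 0.
Proof.
by rewrite !mxE; congr (u 0 _ * v 0 _ - u 0 _ * v 0 _); exact/val_inj.
Qed.

Definition coords3E := (dotv3E, crossv0E, crossv1E, crossv2E, mxE).

Lemma dotv_crossvA u v w : dotv (crossv u v) w = dotv u (crossv v w).
Proof. by rewrite !coords3E; ring. Qed.

Lemma dotvC u v : dotv u v = dotv v u.
Proof. by rewrite !coords3E; ring. Qed.

Lemma crossvC u v : crossv u v = - crossv v u.
Proof. by apply: row3P; rewrite !coords3E; ring. Qed.

Lemma crossv_crossv u v w :
  crossv u (crossv v w) = dotv u w *: v - dotv u v *: w.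
Proof. by apply: row3P; rewrite !coords3E; ring. Qed.

Lemma dotv_crossv_crossv u v w x :
  dotv (crossv u v) (crossv w x) = dotv u w * dotv v x - dotv u x * dotv v w.
Proof. by rewrite !coords3E; ring. Qed.

Lemma dotvDl u v w : dotv (u + v) w = dotv u w + dotv v w.
Proof. by rewrite !coords3E; ring. Qed.

Lemma dotvZl a u v : dotv (a *: u) v = a * dotv u v.
Proof. by rewrite !coords3E; ring. Qed.

Lemma dotvZr a u v : dotv u (a *: v) = a * dotv u v.
Proof. by rewrite !coords3E; ring. Qed.

Lemma crossvDl u v w : crossv (u + v) w = crossv u w + crossv v w.
Proof. by apply: row3P; rewrite !coords3E; ring. Qed.

Lemma crossvZl a u v : crossv (a *: u) v = a *: crossv u v.
Proof. by apply: row3P; rewrite !coords3E; ring. Qed.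

Lemma dotvv_eq0 u : (dotv u u == 0) = (u == 0).
Proof.
apply/eqP/eqP => [|->]; last by rewrite !coords3E; ring.
rewrite dotv3E -!expr2 => /eqP.
rewrite paddr_eq0 ?addr_ge0 ?sqr_ge0// paddr_eq0 ?sqr_ge0// !sqrf_eq0.
by case/andP=> /andP[/eqP h0 /eqP h1] /eqP h2; apply: row3P; rewrite mxE.
Qed.

Lemma enormK u : enorm u ^+ 2 = dotv u u.
Proof. by rewrite /enorm sqr_sqrtr// dotv3E -!expr2 !addr_ge0 ?sqr_ge0. Qed.

(** Cramer's rule for the triple [u], [v], [crossv u v]: each coefficient is the determinant of the
    triple with one entry replaced by [w]. Free of division, it also covers dependent [u] and
    [v]. *)
Lemma crossv_basis u v w :
  dotv (crossv u v) (crossv u v) *: w =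
  dotv (crossv w v) (crossv u v) *: u + dotv (crossv u w) (crossv u v) *: v +
  dotv w (crossv u v) *: crossv u v.
Proof. by apply: row3P; rewrite !coords3E; ring. Qed.

(** Explicit solution [r] of [crossv r u = x] and [crossv r v = y], under the conditions of
    [rotv_spec]. A closed formula makes the smoothness of the rotation field a matter of closure
    properties. *)
Definition rotv u v x y : 'rV[R]_3 :=
  let n := crossv u v in
  (dotv n n)^-1 *:
    (dotv x v *: n + (dotv y n *: u + (- dotv x n) *: v)).

(** The scalar hypotheses say that the linear map sending [u] to [x] and [v] to [y] is skew for the
    dot product; such a map is the cross product with a fixed vector. *)
Lemma rotv_spec u v x y : crossv u v != 0 ->
  dotv u x = 0 -> dotv v y = 0 -> dotv u y + dotv v x = 0 ->
  crossv (rotv u v x y) u = x /\ crossv (rotv u v x y) v = y.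
Proof.
rewrite -dotvv_eq0 => n0 ux vy uyvx.
have uy : dotv y u = - dotv x v.
  by apply/eqP; rewrite -addr_eq0 (dotvC y) (dotvC x); apply/eqP.
have key w z : dotv (crossv u v) (crossv u v) *: z = w ->
    (dotv (crossv u v) (crossv u v))^-1 *: w = z.
  by move=> <-; rewrite scalerA mulVf// scale1r.
split; rewrite /rotv crossvZl; apply: key; rewrite crossv_basis.
  by rewrite !dotv_crossv_crossv (dotvC x u) ux; apply: row3P;
    rewrite !coords3E; ring.
by rewrite !dotv_crossv_crossv (dotvC y v) vy uy; apply: row3P;
  rewrite !coords3E; ring.
Qed.

(** All three coefficients of [d] in [crossv_basis] depend only on [crossv d u] and [crossv d v],
    because [dotv d (crossv u v)] equals [dotv (crossv d u) v]. *)
Lemma crossv_inj2 u v d w : crossv u v != 0 ->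
  crossv d u = crossv w u -> crossv d v = crossv w v -> d = w.
Proof.
rewrite -dotvv_eq0 => n0 du dv.
apply: (scalerI n0); rewrite (crossv_basis u v d) (crossv_basis u v w) dv.
rewrite (crossvC u d) (crossvC u w) du; congr (_ + _ *: _).
by rewrite -!dotv_crossvA du.
Qed.

Lemma orthogonal_collinear u v w : crossv u v != 0 ->
  dotv u w = 0 -> dotv v w = 0 ->
  w = (dotv w (crossv u v) / dotv (crossv u v) (crossv u v)) *: crossv u v.
Proof.
rewrite -dotvv_eq0 => n0 uw vw; apply: (scalerI n0); rewrite scalerA.
rewrite mulrCA divff// mulr1 crossv_basis !dotv_crossv_crossv.
by rewrite !(dotvC w) uw vw !(mul0r, mulr0) subrr !scale0r !add0r.
Qed.

Lemma orthogonal_span u v w x : crossv u v != 0 -> x != 0 ->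
  dotv u x = 0 -> dotv v x = 0 -> dotv w x = 0 ->
  exists a b, w = a *: u + b *: v.
Proof.
move=> n0 x0 ux vx wx; have xE := orthogonal_collinear n0 ux vx.
have wn : dotv w (crossv u v) = 0.
  move: wx x0; rewrite xE dotvZr => /eqP; rewrite mulf_eq0.
  by case/orP => [/eqP->|/eqP//]; rewrite scale0r eqxx.
have nn := n0; rewrite -dotvv_eq0 in nn.
exists (dotv (crossv w v) (crossv u v) / dotv (crossv u v) (crossv u v)).
exists (dotv (crossv u w) (crossv u v) / dotv (crossv u v) (crossv u v)).
apply: (scalerI nn); rewrite crossv_basis wn scale0r addr0.
by rewrite scalerDr !scalerA; congr (_ *: _ + _ *: _); field.
Qed.

Lemma crossv_neq0 u v w : crossv u v != 0 -> dotv u w = 0 -> dotv v w = 0 ->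
  w != 0 -> dotv (crossv u v) w != 0.
Proof.
move=> n0 uw vw; apply: contra => /eqP nw.
by rewrite (orthogonal_collinear n0 uw vw) dotvC nw mul0r scale0r.
Qed.

(** The product of [w] with [crossv u v] vanishes, and expanding a second product with [w] gives the
    factor. Dependent [u] and [v] are allowed, as a deformed map may fail to be an immersion. *)
Lemma crossv_orthogonal u v w : w != 0 -> dotv u w = 0 -> dotv v w = 0 ->
  crossv u v = (dotv (crossv u v) w / dotv w w) *: w.
Proof.
rewrite -dotvv_eq0 => w0 uw vw.
have wn := crossv_crossv w u v.
rewrite !(dotvC w) uw vw !scale0r subrr in wn.
have := crossv_crossv w w (crossv u v).
rewrite wn (_ : crossv w 0 = 0); last by apply: row3P; rewrite !coords3E; ring.
move=> /eqP; rewrite eq_sym subr_eq0 => /eqP E.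
by apply: (scalerI w0); rewrite scalerA mulrCA divff// mulr1 -E dotvC.
Qed.

Lemma det2E (M : 'M[R]_2) : \det M = M 0 0 * M 1 1 - M 0 1 * M 1 0.
Proof.
rewrite (expand_det_row _ 0) !big_ord_recr big_ord0 /= add0r.
rewrite /cofactor !det_mx11 !mxE /= expr0 expr1 mul1r mulN1r mulrN.
congr (M _ _ * M _ _ - M _ _ * M _ _); exact/val_inj.
Qed.

(** Here [f0], [f1] stand for the partial derivatives of a map, [x00] to [x11] for its second
    derivatives, and [p] for a normal field with partial derivatives [p0], [p1]. Writing
    [crossv f0 f1] as [k *: p] reduces the second fundamental determinant to the product of
    [crossv f0 f1] and [crossv p0 p1]. *)
Lemma curvature_algebra (f0 f1 p0 p1 x00 x01 x10 x11 p : 'rV[R]_3) :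
  p != 0 -> dotv f0 p = 0 -> dotv f1 p = 0 ->
  dotv x00 p = - dotv f0 p0 -> dotv x01 p = - dotv f1 p0 ->
  dotv x10 p = - dotv f0 p1 -> dotv x11 p = - dotv f1 p1 ->
  let n := (enorm (crossv f0 f1))^-1 *: crossv f0 f1 in
  (dotv x00 n * dotv x11 n - dotv x01 n * dotv x10 n) /
    (dotv f0 f0 * dotv f1 f1 - dotv f0 f1 * dotv f1 f0) =
  dotv p (crossv p0 p1) / (dotv p p * dotv (crossv f0 f1) p).
Proof.
move=> np0 f0p f1p h00 h01 h10 h11 n; rewrite /n {n} -dotv_crossv_crossv.
have nE := crossv_orthogonal np0 f0p f1p.
have detII := dotv_crossv_crossv f0 f1 p0 p1.
have sE := enormK (crossv f0 f1).
have pp0 : dotv p p != 0 by rewrite dotvv_eq0.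
move: nE detII sE; set k := _ / _; set s := enorm _; set m := crossv f0 f1.
clearbody k s m => mE detII sE.
rewrite {m}mE !dotvZr !dotvZl in detII sE *; rewrite h00 h01 h10 h11.
set A := dotv p (crossv p0 p1) in detII *.
rewrite (_ : _ - _ = (s^-1 * k) ^+ 2 * (k * A)); last by rewrite detII; ring.
(* For [k = 0] the left numerator and the right denominator are 0, so both sides are 0 because the
   inverse of 0 is 0. *)
have [->|k0] := eqVneq k 0; first by rewrite !(mul0r, mulr0, invr0).
by rewrite exprMn exprVn sE; field; rewrite pp0 k0.
Qed.

(** Pairing the equation with [u] and with [v] kills the triple products of [a] and [b] with
    [crossv u v], of which [w] is a multiple. It is meant for [a], [b] the partial derivatives of a
    rotation field. *)
Lemma crossv_eq_orthogonal u v a b w : crossv u v != 0 ->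
  crossv a v = crossv b u -> dotv u w = 0 -> dotv v w = 0 ->
  dotv a w = 0 /\ dotv b w = 0.
Proof.
move=> n0 E uw vw.
have bn : dotv b (crossv u v) = 0.
  by rewrite -dotv_crossvA -E !coords3E; ring.
have an : dotv a (crossv u v) = 0.
  have -> : dotv a (crossv u v) = - dotv (crossv a v) u.
    by rewrite !coords3E; ring.
  by rewrite E !coords3E; ring.
by rewrite (orthogonal_collinear n0 uw vw) !dotvZr an bn mulr0.
Qed.

Lemma dotv_comb_eq0 (s t : R) u v w : dotv u w = 0 -> dotv v w = 0 ->
  dotv (s *: u + t *: v) w = 0.
Proof. by move=> uw vw; rewrite dotvDl !dotvZl uw vw !mulr0 addr0. Qed.

(** The double products collapse to multiples of [p], with total factor [dotv b x - dotv a y]. *)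
Lemma dotv_crossv_variation p a b x y :
  dotv x p = 0 -> dotv y p = 0 -> dotv a y = dotv b x ->
  dotv (crossv (crossv p a) y + crossv x (crossv p b)) p = 0.
Proof.
move=> xp yp ab; rewrite (crossvC (crossv p a)) !crossv_crossv.
by rewrite xp yp (dotvC y) (dotvC x) ab !scale0r !coords3E; ring.
Qed.

(** All four vectors lie in the plane orthogonal to [p], so both cross products are multiples of [p]
    and their sum is detected by its product with [p]. *)
Lemma crossv_add_eq0 p a b x y : p != 0 ->
  dotv a p = 0 -> dotv b p = 0 -> dotv x p = 0 -> dotv y p = 0 ->
  dotv (crossv a y + crossv x b) p = 0 -> crossv a y = crossv b x.
Proof.
move=> p0 ap bp xp yp; rewrite dotvDl => E.
have -> : crossv b x = - crossv x b by rewrite crossvC.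
apply/eqP; rewrite -addr_eq0; apply/eqP.
rewrite (crossv_orthogonal p0 ap yp) (crossv_orthogonal p0 xp bp).
by rewrite -scalerDl -mulrDl E mul0r scale0r.
Qed.

Lemma dotv_row_crossv (f : 'I_2 -> 'rV[R]_3) a (v : 'rV[R]_2) k :
  dotv (\row_j crossv (f j) a 0 k) v =
  crossv (v 0 0 *: f 0 + v 0 1 *: f 1) a 0 k.
Proof.
rewrite crossvDl !crossvZl /dotv !big_ord_recr big_ord0 /= add0r !mxE.
rewrite (_ : widen_ord _ _ = 0); last exact/val_inj.
rewrite (_ : ord_max = 1); last exact/val_inj.
by rewrite ![_ * v _ _]mulrC.
Qed.

End VectorAlgebra.

(** * Differentiable functions *)

Section Calculus.
Variable R : realType.

Lemma near_eq_differentiable (V W : normedModType R) (f g : V -> W) (x : V) :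
  (\forall y \near x, f y = g y) -> differentiable f x -> differentiable g x.
Proof.
move=> fg df; have dfc := diff_continuous df.
have gE : g \o shift x = cst (g x) + 'd f x +o_ 0 id.
  have /eqaddoP fo := diff_locally df.
  have fg0 : \forall y \near (0 : V), f (y + x) = g (y + x).
    by move: fg; rewrite (near_shift 0) subr0.
  apply/eqaddoP => e e0; move: fg0 (fo e e0); apply: filterS2 => y /= fgy.
  by rewrite !fctE /cst /= fgy (nbhs_singleton fg).
have dg := diff_unique dfc gE.
by apply/diff_locallyP; split; rewrite dg.
Qed.

Lemma differentiable_row (V : normedModType R) n (F : V -> 'rV[R]_n.+1) x :
  (forall i, differentiable (fun y => F y 0 i : R) x) -> differentiable F x.
Proof.
move=> dF.
have -> : F =
    \sum_(k < n.+1) (fun y => F y 0 k *: (delta_mx 0 k : 'rV[R]_n.+1)).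
  by apply/funext => y; rewrite fct_sumE; exact: row_sum_delta.
by apply: differentiable_sum => k; exact: differentiableZl.
Qed.

Lemma derive_comp (U V W : normedModType R) (g : U -> V) (f : V -> W) x v :
  differentiable g x -> differentiable f (g x) ->
  'D_v (f \o g) x = 'D_('D_v g x) f (g x).
Proof.
move=> dg df; rewrite !deriveE//; last exact: differentiable_comp.
by rewrite diff_comp.
Qed.

Lemma derive_row (V : normedModType R) n (F : V -> 'rV[R]_n) x v i :
  differentiable F x -> ('D_v F x) 0 i = 'D_v (fun y => F y 0 i) x.
Proof. by move=> dF; rewrite derive_mx ?mxE//; exact: diff_derivable. Qed.

Lemma differentiable_entry (V : normedModType R) n (F : V -> 'rV[R]_n) x i :
  differentiable F x -> differentiable (fun y => F y 0 i : R) x.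
Proof.
move=> dF.
apply: (@differentiable_comp _ _ _ _ F (fun N : 'rV[R]_n => N 0 i : R)) => //.
exact: differentiable_coord.
Qed.

Lemma derive_linear_comb (V W : normedModType R) (f : V -> W) x v w (a b : R) :
  differentiable f x ->
  'D_(a *: v + b *: w) f x = a *: 'D_v f x + b *: 'D_w f x.
Proof. by move=> df; rewrite !deriveE// linearD !linearZ. Qed.

(** Both the deformed metric and the denominator of the deformed curvature are quadratic polynomials
    in the time [t]. *)
Lemma is_derive_quadratic (a b d : R) :
  is_derive (0 : R^o) (1 : R^o) (fun t : R^o => a + t * b + t * t * d : R^o) b.
Proof.
have -> : (fun t : R^o => a + t * b + t * t * d : R^o) =
  cst a + b *: (id : R -> R) + d *: ((id : R -> R) * (id : R -> R)).
  by apply/funext => t; rewrite !fctE /GRing.scale /=; ring.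
have di : is_derive (0 : R) (1 : R) (id : R -> R) 1 by exact: is_derive_id.
have da : is_derive (0 : R) (1 : R) (cst a : R -> R) 0 by exact: is_derive_cst.
have := is_deriveD (is_deriveD da (is_deriveZ b di))
  (is_deriveZ d (is_deriveM di di)).
by rewrite /= scale0r addr0 scaler0 add0r addr0 [b *: 1]mulr1.
Qed.

Lemma is_derive_inv_quadratic (C k a b d : R) : k != 0 -> a != 0 ->
  is_derive (0 : R^o) (1 : R^o)
    (fun t : R^o => C / (k * (a + t * b + t * t * d)) : R^o)
    (- (C / k * b / a ^+ 2)).
Proof.
move=> k0 a0; have dq := is_derive_quadratic a b d.
set q := fun t : R^o => _ in dq.
have q0 : q 0 = a by rewrite /q !mul0r !addr0.
have dq1 : derivable q 0 1 by exact: ex_derive.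
have qn0 : q 0 != 0 by rewrite q0.
have -> : (fun t : R^o => C / (k * (a + t * b + t * t * d)) : R^o) =
  (C / k) *: (fun t => (q t)^-1).
  by apply/funext => t; rewrite fctE /GRing.scale /= invfM mulrA.
apply: DeriveDef; first by apply: derivableZ; exact: derivableV.
rewrite deriveZ; last exact: derivableV.
by rewrite deriveV// derive_val q0 /GRing.scale /=; field; rewrite a0.
Qed.

End Calculus.

(** * Differentiability of finite order and its closure properties *)

Section SmoothFunctions.
Variable R : realType.
Variable U : set 'rV[R]_2.
Hypothesis U_open : open U.

Local Notation V := 'rV[R]_2.

Lemma derive_ext (W : normedModType R) (f g : V -> W) (u v : V) :
  U u -> (forall x, U x -> f x = g x) -> 'D_v f u = 'D_v g u.
Proof.
move=> Uu fg; apply: near_eq_derive.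
by apply: filterS (open_nbhs_nbhs (conj U_open Uu)) => x; exact: fg.
Qed.

Lemma differentiable_ext (W : normedModType R) (f g : V -> W) (u : V) :
  U u -> (forall x, U x -> f x = g x) ->
  differentiable f u -> differentiable g u.
Proof.
move=> Uu fg; apply: near_eq_differentiable.
by apply: filterS (open_nbhs_nbhs (conj U_open Uu)) => x; exact: fg.
Qed.

(** Finite-order form of [smooth_on], suited to induction: the Leibniz rule expresses a derivative
    of a product through products of functions that are controlled to the next lower order. *)
Fixpoint diffn (W : normedModType R) n (f : V -> W) : Prop :=
  (forall u, U u -> differentiable f u) /\
  (if n is n'.+1 then forall v, diffn n' ('D_v f) else True).

Lemma diffnP (W : normedModType R) (f : V -> W) :
  smooth_on U f <-> forall n, diffn n f.
Proof.
split=> [sf n|].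
  elim: n f sf => [|n IHn] f sf /=; split=> //; try exact: (sf [::]).
  (* [foldr] differentiates in the last direction of the list first, hence [rcons]. *)
  by move=> v; apply: IHn => vs; have := sf (rcons vs v); rewrite foldr_rcons.
move=> df vs; elim/last_ind: vs f df => [|vs v IHvs] f df.
  exact: (df 0).1.
by rewrite foldr_rcons; apply: IHvs => n; apply: (df n.+1).2.
Qed.

Lemma diffnS (W : normedModType R) n (f : V -> W) : diffn n.+1 f -> diffn n f.
Proof.
by elim: n f => [|n IHn] f [df Df]; split=> // v; apply: IHn; exact: Df.
Qed.

Lemma diffn_ext (W : normedModType R) n (f g : V -> W) :
  (forall x, U x -> f x = g x) -> diffn n f -> diffn n g.
Proof.
elim: n f g => [|n IHn] f g fg [df Df]; split=> //.
- by move=> u Uu; apply: differentiable_ext (df u Uu).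
- by move=> u Uu; apply: differentiable_ext (df u Uu).
- by move=> v; apply: IHn (Df v) => x Ux; exact: derive_ext.
Qed.

Lemma diffnD (W : normedModType R) n (f g : V -> W) :
  diffn n f -> diffn n g -> diffn n (f + g).
Proof.
elim: n f g => [|n IHn] f g [df Df] [dg Dg]; split=> //.
- by move=> u Uu; apply: differentiableD; [exact: df|exact: dg].
- by move=> u Uu; apply: differentiableD; [exact: df|exact: dg].
- move=> v; apply: (@diffn_ext _ n ('D_v f + 'D_v g)); last first.
    by apply: IHn; [exact: Df|exact: Dg].
  move=> x Ux; rewrite deriveD//; apply: diff_derivable; [exact: df|exact: dg].
Qed.

Lemma diffnN (W : normedModType R) n (f : V -> W) :
  diffn n f -> diffn n (- f).
Proof.
elim: n f => [|n IHn] f [df Df]; split=> //.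
- by move=> u Uu; apply: differentiableN; exact: df.
- by move=> u Uu; apply: differentiableN; exact: df.
- move=> v; apply: (@diffn_ext _ n (- 'D_v f)); last by apply: IHn; exact: Df.
  by move=> x Ux; rewrite deriveN//; apply: diff_derivable; exact: df.
Qed.

Lemma diffnM n (f g : V -> R) : diffn n f -> diffn n g -> diffn n (f * g).
Proof.
elim: n f g => [|n IHn] f g [df Df] [dg Dg]; split=> //.
- by move=> u Uu; apply: differentiableM; [exact: df|exact: dg].
- by move=> u Uu; apply: differentiableM; [exact: df|exact: dg].
- move=> v; apply: (@diffn_ext _ n (f * 'D_v g + g * 'D_v f)).
    move=> x Ux; rewrite deriveM//; apply: diff_derivable;
     [exact: df|exact: dg].
  have df' : diffn n f by apply: diffnS; split.
  have dg' : diffn n g by apply: diffnS; split.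
  by apply: diffnD; apply: IHn => //; [exact: Dg|exact: Df].
Qed.

(** The derivative of the inverse again contains the inverse, but only to order [n], which the
    induction hypothesis supplies. *)
Lemma diffnV n (f : V -> R) :
  (forall u, U u -> f u != 0) -> diffn n f -> diffn n (fun x => (f x)^-1).
Proof.
move=> f0; elim: n f f0 => [|n IHn] f f0 [df Df]; split=> //.
- by move=> u Uu; apply: differentiableV; [exact: df|exact: f0].
- by move=> u Uu; apply: differentiableV; [exact: df|exact: f0].
- move=> v; have iV : diffn n (fun x => (f x)^-1).
    by apply: IHn => //; apply: diffnS; split.
  apply: (@diffn_ext _ n (- ((fun x => (f x)^-1) * (fun x => (f x)^-1)
     * 'D_v f))).
    move=> x Ux; rewrite deriveV//; last by apply/diff_derivable/df.
      by rewrite !fctE /= -exprVn expr2 -mulNr.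
    exact: f0.
  by apply: diffnN; apply: diffnM (Df v); exact: diffnM.
Qed.

Lemma diffn_rowP n k (F : V -> 'rV[R]_k.+1) :
  diffn n F <-> forall i, diffn n (fun x => F x 0 i : R).
Proof.
elim: n F => [|n IHn] F; split.
- by move=> [dF _] i; split=> // u Uu; apply/differentiable_entry/dF.
- move=> dF; split=> // u Uu; apply/differentiable_row => i.
  by have [+ _] := dF i; exact.
- move=> [dF DF] i; split=> [u Uu|v]; first by apply/differentiable_entry/dF.
  apply: (@diffn_ext _ n (fun x => 'D_v F x 0 i)).
    by move=> x Ux; rewrite derive_row//; exact: dF.
  by move: i; apply/IHn; exact: DF.
- move=> dF; have dF1 u : U u -> differentiable F u.
    by move=> Uu; apply/differentiable_row => i; have [+ _] := dF i; exact.
  split=> // v; apply/IHn => i.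
  apply: (@diffn_ext _ n ('D_v (fun x => F x 0 i : R))).
    by move=> x Ux; rewrite derive_row//; exact: dF1.
  by have [_] := dF i; exact.
Qed.

End SmoothFunctions.

(** * Product rules, mean value theorem and symmetry of second derivatives *)

Section VectorCalculus.
Variables (R : realType) (V : normedModType R).
Implicit Types (F G : V -> 'rV[R]_3) (f : V -> R) (x v w : V).

Lemma dotv_fctE F G : (fun x => dotv (F x) (G x)) =
  (fun x => F x 0 0 : R) * (fun x => G x 0 0) +
  (fun x => F x 0 1 : R) * (fun x => G x 0 1) +
  (fun x => F x 0 2 : R) * (fun x => G x 0 2).
Proof. by apply/funext => x; rewrite dotv3E. Qed.

Lemma derive_dotv F G x v : differentiable F x -> differentiable G x ->
  'D_v (fun y => dotv (F y) (G y) : R) x =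
  dotv ('D_v F x) (G x) + dotv (F x) ('D_v G x).
Proof.
move=> dF dG; rewrite dotv_fctE.
have dFi i := differentiable_entry i dF.
have dGi i := differentiable_entry i dG.
have dM i : derivable ((fun x => F x 0 i : R) * (fun x => G x 0 i)) x v.
  by apply: derivableM; exact: diff_derivable.
rewrite (deriveD (derivableD (dM 0) (dM 1)) (dM 2)).
rewrite deriveD// !deriveM//; try exact: diff_derivable.
by rewrite -!derive_row// !dotv3E /GRing.scale /=; ring.
Qed.

Lemma differentiable_crossv F G x : differentiable F x -> differentiable G x ->
  differentiable (fun y => crossv (F y) (G y)) x.
Proof.
move=> dF dG; apply: differentiable_row => i.
have -> : (fun y => crossv (F y) (G y) 0 i : R) =
  (fun y => F y 0 (i + 1) : R) * (fun y => G y 0 (i + 2)) -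
  (fun y => F y 0 (i + 2) : R) * (fun y => G y 0 (i + 1)).
  by apply/funext => y; rewrite mxE.
by apply: differentiableB; apply: differentiableM; exact: differentiable_entry.
Qed.

Lemma derive_crossv F G x v : differentiable F x -> differentiable G x ->
  'D_v (fun y => crossv (F y) (G y)) x =
  crossv ('D_v F x) (G x) + crossv (F x) ('D_v G x).
Proof.
move=> dF dG; apply/rowP => i.
rewrite derive_row; last exact: differentiable_crossv.
have -> : (fun y => crossv (F y) (G y) 0 i : R) =
  (fun y => F y 0 (i + 1) : R) * (fun y => G y 0 (i + 2)) -
  (fun y => F y 0 (i + 2) : R) * (fun y => G y 0 (i + 1)).
  by apply/funext => y; rewrite mxE.
have dFi j := differentiable_entry j dF.
have dGi j := differentiable_entry j dG.
have dM j k : derivable ((fun x => F x 0 j : R) * (fun x => G x 0 k)) x v.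
  by apply: derivableM; exact: diff_derivable.
rewrite deriveB// !deriveM//; try exact: diff_derivable.
by rewrite -!derive_row// !mxE /GRing.scale /=; ring.
Qed.

Lemma is_derive_line f x v (s : R) : differentiable f (x + s *: v) ->
  is_derive s 1 (fun t : R => f (x + t *: v)) ('D_v f (x + s *: v)).
Proof.
move=> df.
pose g := fun t : R => x + t *: v.
have dg : is_diff s g ( *:%R^~ v).
  have := is_diffD (is_diff_cst x s) (is_diff_scalel s v).
  by rewrite add0r.
have dgs : differentiable g s by [].
have fg : differentiable (f \o g) s by exact: differentiable_comp.
have Dg : 'D_1 g s = v by rewrite deriveE// diff_val scale1r.
have -> : 'D_v f (x + s *: v) = 'D_1 (f \o g) s.
  by rewrite (@derive_comp _ _ _ _ g f s 1 dgs)// Dg.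
by apply/derivableP/diff_derivable.
Qed.

Lemma MVT_line f x v (h : R) : 0 < h ->
  (forall s, 0 <= s <= h -> differentiable f (x + s *: v)) ->
  exists2 s, 0 < s < h & f (x + h *: v) - f x = h * 'D_v f (x + s *: v).
Proof.
move=> h0 df.
pose g (t : R) := f (x + t *: v); pose dg (t : R) := 'D_v f (x + t *: v).
have gd (s : R) : 0 <= s <= h -> is_derive s 1 g (dg s).
  by move=> /df; exact: is_derive_line.
have gd' (s : R) : s \in `]0, h[%R -> is_derive s 1 g (dg s).
  by rewrite in_itv/= => /andP[s0 sh]; apply: gd; rewrite !ltW.
have gc : {within `[0, h], continuous g}.
  apply: derivable_within_continuous => s; rewrite in_itv/= => /gd ds.
  exact: ex_derive.
have [s] := MVT h0 gd' gc.
rewrite in_itv/= subr0 /g /dg scale0r addr0 mulrC => sh E.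
by exists s.
Qed.

(* The mean value theorem, applied once in direction [v] and once in
   direction [w]. *)
Lemma second_difference f x v w (h : R) : 0 < h ->
  (forall a b, 0 <= a <= h -> 0 <= b <= h ->
    differentiable f (x + a *: v + b *: w) /\
    differentiable ('D_v f) (x + a *: v + b *: w)) ->
  exists a b, [/\ 0 < a < h, 0 < b < h &
    f (x + h *: v + h *: w) - f (x + h *: v) - (f (x + h *: w) - f x) =
    h * (h * 'D_w ('D_v f) (x + a *: v + b *: w))].
Proof.
move=> h0 df.
have h00 : 0 <= (0 : R) <= h by rewrite lexx ltW.
have hh : 0 <= h <= h by rewrite lexx ltW.
pose g := f \o shift (h *: w) - f.
have dsh (y : V) : differentiable (shift (h *: w)) y by [].
have dfs a : 0 <= a <= h -> differentiable (f \o shift (h *: w)) (x + a *: v).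
  by move=> ah; apply: differentiable_comp => //; exact: (df a h ah hh).1.
have dfa a : 0 <= a <= h -> differentiable f (x + a *: v).
  by move=> ah; have := (df a 0 ah h00).1; rewrite scale0r addr0.
have [a ah ga] : exists2 a, 0 < a < h &
    g (x + h *: v) - g x = h * 'D_v g (x + a *: v).
  by apply: (@MVT_line g x v h h0) => s sh; apply: differentiableB;
    [exact: dfs|exact: dfa].
have [a0 a1] := andP ah.
have ah' : 0 <= a <= h by rewrite !ltW.
have [b bh fb] : exists2 b, 0 < b < h &
    'D_v f (x + a *: v + h *: w) - 'D_v f (x + a *: v) =
    h * 'D_w ('D_v f) (x + a *: v + b *: w).
  by apply: (@MVT_line ('D_v f) (x + a *: v) w h h0) => s sh;
    exact: (df a s ah' sh).2.
exists a, b; split=> //; rewrite -fb.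
transitivity (g (x + h *: v) - g x); first by [].
rewrite ga; congr (_ * _); rewrite deriveB; last 2 first.
- by apply/diff_derivable/dfs.
- by apply/diff_derivable/dfa.
have Dsh (y : V) : 'D_v (shift (h *: w)) y = v.
  rewrite deriveE// (_ : shift (h *: w) = id + cst (h *: w))//.
  by rewrite diffD// diff_cst diff_val/= addr0.
congr (_ - _).
rewrite (@derive_comp _ _ _ _ (shift (h *: w)) f _ v (dsh _)) ?Dsh//.
exact: (df a h ah' hh).1.
Qed.

(** Schwarz's theorem. The second difference of [f] over a small parallelogram is symmetric in [v]
    and [w], and [second_difference] makes it [h * h] times either mixed derivative at some point
    nearby; continuity carries both values back to [x]. *)
Lemma derive_swap f x v w :
  (\forall y \near x, differentiable f y) ->
  (\forall y \near x, differentiable ('D_v f) y) ->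
  (\forall y \near x, differentiable ('D_w f) y) ->
  {for x, continuous ('D_w ('D_v f))} -> {for x, continuous ('D_v ('D_w f))} ->
  'D_w ('D_v f) x = 'D_v ('D_w f) x.
Proof.
move=> df dvf dwf cwv cvw; apply/eqP; rewrite -subr_eq0 -normr_le0.
apply/ler_addgt0Pr => e e0; rewrite add0r.
have e2 : 0 < e / 2 by rewrite divr_gt0.
have nb : \forall y \near x, [/\ differentiable f y, differentiable ('D_v f) y,
    differentiable ('D_w f) y,
    `|'D_w ('D_v f) x - 'D_w ('D_v f) y| < e / 2 &
    `|'D_v ('D_w f) x - 'D_v ('D_w f) y| < e / 2].
  have c1 := (cvgrPdist_lt _ _).1 cwv _ e2.
  have c2 := (cvgrPdist_lt _ _).1 cvw _ e2.
  apply: filterS (filterI (filterI df dvf)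
    (filterI dwf (filterI (c1 _) (c2 _)))).
  by move=> y [[h1 h2] [h3 [h4 h5]]]; exact: (And5 h1 h2 h3 h4 h5).
have /nbhs_ballP[r /= r0 rP] := nb.
(* With sides scaled by [r / K] the parallelogram stays in the ball of radius [r]; the summand 1
   makes [K] positive and the bound strict. *)
pose K := `|v| + `|w| + 1.
have K0 : 0 < K by rewrite ltr_wpDl// addr_ge0.
pose h := r / K; have h0 : 0 < h by rewrite divr_gt0.
have inb a b : 0 <= a <= h -> 0 <= b <= h -> ball x r (x + a *: v + b *: w).
  move=> /andP[a0 ah] /andP[b0 bh].
  rewrite -ball_normE /= -addrA opprD addNKr normrN.
  apply: le_lt_trans (ler_normD _ _) _.
  rewrite !normrZ !ger0_norm//.
  apply: (@le_lt_trans _ _ (h * `|v| + h * `|w|)).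
    by rewrite lerD// ler_wpM2r.
  rewrite -mulrDr -[ltRHS](@divfK _ K) ?gt_eqF// ltr_pM2l//.
  by rewrite ltrDl.
have [|a [b [ah bh E1]]] := @second_difference f x v w h h0.
  move=> a b ah bh.
  by have [h1 h2 _ _ _] := rP _ (inb a b ah bh); exact: (conj h1 h2).
have [|b' [a' [bh' ah' E2]]] := @second_difference f x w v h h0.
  move=> s t sh th; rewrite addrAC.
  by have [h1 _ h3 _ _] := rP _ (inb t s th sh); exact: (conj h1 h3).
have W (s : R) : 0 < s < h -> 0 <= s <= h by case/andP=> ? ?; rewrite !ltW.
have [_ _ _ D1 _] := rP _ (inb a b (W _ ah) (W _ bh)).
have [_ _ _ _ D2] := rP _ (inb a' b' (W _ ah') (W _ bh')).
rewrite (addrAC x (a' *: v)) in D2; rewrite (addrAC x (h *: w)) in E2.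
have aux (A B P Q d d' : R) : d = h * (h * P) -> d' = h * (h * Q) -> d = d' ->
    `|A - P| < e / 2 -> `|B - Q| < e / 2 -> `|A - B| <= e.
  move=> -> -> /(mulfI (lt0r_neq0 h0)) /(mulfI (lt0r_neq0 h0)) <- AP BP.
  rewrite (_ : A - B = (A - P) - (B - P)); last by ring.
  by apply: le_trans (ler_normB _ _) _; rewrite [leRHS]splitr lerD// ltW.
by apply: (aux _ _ _ _ _ _ E1 E2 _ D1 D2); ring.
Qed.

(** Mean value theorem on the segment from [x] to [y], which stays in the ball, one entry of [F] at
    a time. *)
Lemma constant_on_ball F x (r : R) :
  (forall y, ball x r y -> differentiable F y) ->
  (forall y v, ball x r y -> 'D_v F y = 0) ->
  forall y, ball x r y -> F y = F x.
Proof.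
move=> dF DF y xy; apply/rowP => i; apply/eqP; rewrite -subr_eq0.
have r0 : 0 < r by move: xy; rewrite -ball_normE /=; exact: le_lt_trans.
have inb s : 0 <= s <= 1 -> ball x r (x + s *: (y - x)).
  move=> /andP[s0 s1]; move: xy; rewrite -!ball_normE /= opprD addNKr normrN.
  apply: le_lt_trans; rewrite normrZ ger0_norm// distrC.
  by rewrite ler_piMl.
have [||s sh] := @MVT_line (fun y => F y 0 i) x (y - x) 1.
- by [].
- by move=> s sh; apply/differentiable_entry/dF/inb.
have [s0 s1] := andP sh; have sb : ball x r (x + s *: (y - x)).
  by apply: inb; rewrite !ltW.
rewrite scale1r (addrC x) subrK mul1r => ->.
by rewrite -derive_row ?DF ?mxE//; exact: dF.
Qed.

End VectorCalculus.

(** * Smooth functions *)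

Section SmoothOn.
Variables (R : realType) (U : set 'rV[R]_2).
Hypothesis U_open : open U.
Local Notation V := 'rV[R]_2.

Lemma smooth_on_ext (W : normedModType R) (f g : V -> W) :
  (forall x, U x -> f x = g x) -> smooth_on U f -> smooth_on U g.
Proof. by move=> fg /diffnP sf; apply/diffnP => n; exact: diffn_ext (sf n). Qed.

Lemma smooth_on_differentiable (W : normedModType R) (f : V -> W) u :
  smooth_on U f -> U u -> differentiable f u.
Proof. by move=> sf; exact: (sf [::]). Qed.

Lemma smooth_on_derive (W : normedModType R) (f : V -> W) v :
  smooth_on U f -> smooth_on U ('D_v f).
Proof. by move=> sf vs; have := sf (rcons vs v); rewrite foldr_rcons. Qed.

Lemma smooth_on_cst (W : normedModType R) (a : W) : smooth_on U (cst a).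
Proof.
move=> vs; elim/last_ind: vs a => [|vs v IHvs] a u Uu.
  exact: differentiable_cst.
rewrite foldr_rcons (_ : 'D_v (cst a) = cst 0); first exact: IHvs.
by apply/funext => x; rewrite derive_cst.
Qed.

Lemma smooth_onD (W : normedModType R) (f g : V -> W) :
  smooth_on U f -> smooth_on U g -> smooth_on U (fun x => f x + g x).
Proof.
move=> /diffnP sf /diffnP sg; apply/diffnP => n.
exact: (diffnD U_open (sf n) (sg n)).
Qed.

Lemma smooth_onM (f g : V -> R^o) :
  smooth_on U f -> smooth_on U g -> smooth_on U (fun x => f x * g x : R^o).
Proof.
move=> /diffnP sf /diffnP sg; apply/diffnP => n.
exact: (diffnM U_open (sf n) (sg n)).
Qed.

Lemma smooth_onN (W : normedModType R) (f : V -> W) :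
  smooth_on U f -> smooth_on U (fun x => - f x).
Proof.
move=> /diffnP sf; apply/diffnP => n; exact: (diffnN U_open (sf n)).
Qed.

Lemma smooth_onV (f : V -> R^o) : (forall x, U x -> f x != 0) ->
  smooth_on U f -> smooth_on U (fun x => (f x)^-1 : R^o).
Proof.
move=> f0 /diffnP sf; apply/diffnP => n; exact: (diffnV U_open f0 (sf n)).
Qed.

Lemma smooth_on_rowP n (F : V -> 'rV[R]_n.+1) :
  smooth_on U F <-> forall i, smooth_on U (fun x => F x 0 i : R^o).
Proof.
split=> [/diffnP sF i|sF]; apply/diffnP => k.
  by have /(diffn_rowP U_open) := sF k; exact.
apply/(diffn_rowP U_open) => i; have /diffnP := sF i; exact.
Qed.

Lemma smooth_onZ n (f : V -> R^o) (F : V -> 'rV[R]_n.+1) :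
  smooth_on U f -> smooth_on U F -> smooth_on U (fun x => f x *: F x).
Proof.
move=> sf /smooth_on_rowP sF; apply/smooth_on_rowP => i.
apply: (@smooth_on_ext _ (fun x => f x * F x 0 i : R^o)).
  by move=> x _; rewrite mxE.
exact: smooth_onM.
Qed.

Lemma smooth_on_dotv (F G : V -> 'rV[R]_3) :
  smooth_on U F -> smooth_on U G ->
  smooth_on U (fun x => dotv (F x) (G x) : R^o).
Proof.
move=> /smooth_on_rowP sF /smooth_on_rowP sG.
apply: (@smooth_on_ext _ (fun x =>
  F x 0 0 * G x 0 0 + F x 0 1 * G x 0 1 + F x 0 2 * G x 0 2 : R^o)).
  by move=> x _; rewrite dotv3E.
by do 2?apply: smooth_onD; exact: smooth_onM.
Qed.

Lemma smooth_on_crossv (F G : V -> 'rV[R]_3) :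
  smooth_on U F -> smooth_on U G -> smooth_on U (fun x => crossv (F x) (G x)).
Proof.
move=> /smooth_on_rowP sF /smooth_on_rowP sG; apply/smooth_on_rowP => i.
apply: (@smooth_on_ext _ (fun x => F x 0 (i + 1) * G x 0 (i + 2) +
    - (F x 0 (i + 2) * G x 0 (i + 1)) : R^o)).
  by move=> x _; rewrite mxE.
by apply: smooth_onD; [|apply: smooth_onN]; exact: smooth_onM.
Qed.

Lemma smooth_on_derive_swap n (F : V -> 'rV[R]_n.+1) u v w :
  smooth_on U F -> U u -> 'D_v ('D_w F) u = 'D_w ('D_v F) u.
Proof.
move=> sF Uu; apply/rowP => i.
have nU : nbhs u U by exact: open_nbhs_nbhs.
have sFi : smooth_on U (fun x => F x 0 i : R^o).
  by have /smooth_on_rowP := sF; exact.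
have dd (a b : V) : ('D_a ('D_b F) u) 0 i =
    'D_a ('D_b (fun x => F x 0 i : R)) u.
  rewrite derive_row; last first.
    exact: smooth_on_differentiable (smooth_on_derive b sF) Uu.
  apply: (derive_ext U_open a Uu) => x Ux.
  by rewrite derive_row//; exact: smooth_on_differentiable.
pose f := fun x => F x 0 i : R.
have nd (g : V -> R) : smooth_on U g -> \forall x \near u, differentiable g x.
  by move=> sg; apply: filterS nU => x; exact: smooth_on_differentiable.
have cd (a b : V) : {for u, continuous ('D_a ('D_b f))}.
  apply: differentiable_continuous; apply: smooth_on_differentiable Uu.
  exact/smooth_on_derive/smooth_on_derive.
have swap : 'D_v ('D_w f) u = 'D_w ('D_v f) u.
  exact: (derive_swap (nd _ sFi) (nd _ (smooth_on_derive w sFi))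
    (nd _ (smooth_on_derive v sFi)) (cd v w) (cd w v)).
exact: (etrans (dd v w) (etrans swap (esym (dd w v)))).
Qed.

End SmoothOn.

(** * Calculus of differentials in a single chart *)

Definition smooth_in (R : realType) (S : surface R) (W : normedModType R)
  (c : chart R S) (f : S -> W) := smooth_on (cod c) (f \o param c).

Local Notation e0 := (delta_mx 0 0).
Local Notation e1 := (delta_mx 0 1).

Section ChartCalculus.
Variables (R : realType) (S : surface R) (c : chart R S).
Let Uo : open (cod c) := @cod_open _ _ c.

Section Generic.
Variable W : normedModType R.
Implicit Types f g : S -> W.

Lemma smooth_in_ext f g : (forall p, dom c p -> f p = g p) ->
  smooth_in c f -> smooth_in c g.
Proof.
move=> fg; apply: (smooth_on_ext Uo) => u Uu /=.
exact/fg/param_dom.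
Qed.

Lemma smooth_in_differentiable f p : smooth_in c f -> dom c p ->
  differentiable (f \o param c) (coord c p).
Proof.
by move=> sf cp; apply: smooth_on_differentiable sf _; exact: coord_cod.
Qed.

Lemma dmap_ext f g p v : (forall q, dom c q -> f q = g q) -> dom c p ->
  dmap c f p v = dmap c g p v.
Proof.
move=> fg cp; apply: (derive_ext Uo); first exact: coord_cod.
by move=> u Uu /=; exact/fg/param_dom.
Qed.

Lemma smooth_in_cst (a : W) : smooth_in c (fun=> a).
Proof. exact: smooth_on_cst. Qed.

Lemma dmap_cst (a : W) p v : dmap c (fun=> a) p v = 0.
Proof. exact: derive_cst. Qed.

Lemma smooth_inD f g :
  smooth_in c f -> smooth_in c g -> smooth_in c (fun p => f p + g p).
Proof. exact: smooth_onD. Qed.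

Lemma smooth_inN f : smooth_in c f -> smooth_in c (fun p => - f p).
Proof. exact: smooth_onN. Qed.

Lemma smooth_in_dmap f v : smooth_in c f -> smooth_in c (fun p => dmap c f p v).
Proof.
move=> sf; apply: (smooth_on_ext Uo (f := 'D_v (f \o param c))).
  by move=> u Uu /=; rewrite /dmap paramK.
exact: smooth_on_derive.
Qed.

Lemma dmapD f g p v : smooth_in c f -> smooth_in c g -> dom c p ->
  dmap c (fun q => f q + g q) p v = dmap c f p v + dmap c g p v.
Proof.
by move=> sf sg cp; apply: deriveD; apply: diff_derivable;
  exact: smooth_in_differentiable.
Qed.

Lemma dmapZ f (a : R) p v : smooth_in c f -> dom c p ->
  dmap c (fun q => a *: f q) p v = a *: dmap c f p v.
Proof.
by move=> sf cp; apply: deriveZ; apply: diff_derivable;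
  exact: smooth_in_differentiable.
Qed.

Lemma dmap_comb f p (a b : R) v w : smooth_in c f -> dom c p ->
  dmap c f p (a *: v + b *: w) = a *: dmap c f p v + b *: dmap c f p w.
Proof. by move=> sf cp; exact/derive_linear_comb/smooth_in_differentiable. Qed.

Lemma dmap_basis f p v : smooth_in c f -> dom c p ->
  dmap c f p v = v 0 0 *: dmap c f p e0 + v 0 1 *: dmap c f p e1.
Proof.
move=> sf cp; rewrite -dmap_comb//; congr (dmap c f p _).
apply/rowP => -[[|[|//]] i]; rewrite !mxE /= ?mulr1 ?mulr0 ?addr0 ?add0r.
  by congr (v 0 _); exact/val_inj.
by congr (v 0 _); exact/val_inj.
Qed.

(** Passes from iterated derivatives in coordinates, as in the curvature and in Schwarz's theorem,
    to iterated [dmap]; the two agree since [coord c] inverts [param c] on the open set [cod c]. *)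
Lemma derive_derive_dmap f p v w : dom c p ->
  'D_v ('D_w (f \o param c)) (coord c p) = dmap c (fun q => dmap c f q w) p v.
Proof.
move=> cp; apply: (derive_ext Uo); first exact: coord_cod.
by move=> u Uu /=; rewrite /dmap paramK.
Qed.

Lemma dmap0 f p : dmap c f p 0 = 0.
Proof. exact: derive0. Qed.

End Generic.

Lemma coord_partialE (f : S -> 'rV[R]_3) p i :
  coord_partial c f i (coord c p) = dmap c f p (delta_mx 0 i).
Proof. by []. Qed.

Lemma derive_coord_partialE (f : S -> 'rV[R]_3) p i j : dom c p ->
  'D_(delta_mx 0 i) (coord_partial c f j) (coord c p) =
  dmap c (fun q => dmap c f q (delta_mx 0 j)) p (delta_mx 0 i).
Proof. exact: derive_derive_dmap. Qed.

Lemma smooth_inV (f : S -> R^o) : (forall p, dom c p -> f p != 0) ->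
  smooth_in c f -> smooth_in c (fun p => (f p)^-1 : R^o).
Proof. by move=> f0; apply: (smooth_onV Uo) => u Uu; exact/f0/param_dom. Qed.

Lemma smooth_inZ n (f : S -> R^o) (F : S -> 'rV[R]_n.+1) :
  smooth_in c f -> smooth_in c F -> smooth_in c (fun p => f p *: F p).
Proof. exact: smooth_onZ. Qed.

Lemma smooth_in_rowP n (F : S -> 'rV[R]_n.+1) :
  smooth_in c F <-> forall i, smooth_in c (fun p => F p 0 i : R^o).
Proof. exact: (smooth_on_rowP Uo). Qed.

Lemma dmap_row n (F : S -> 'rV[R]_n.+1) p v i : smooth_in c F -> dom c p ->
  dmap c F p v 0 i = dmap c (fun q => F q 0 i : R^o) p v.
Proof. by move=> sF cp; exact/derive_row/smooth_in_differentiable. Qed.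

Lemma dmap_swap n (F : S -> 'rV[R]_n.+1) p v w : smooth_in c F -> dom c p ->
  dmap c (fun q => dmap c F q w) p v = dmap c (fun q => dmap c F q v) p w.
Proof.
move=> sF cp; have sw := smooth_on_derive_swap Uo v w sF (coord_cod cp).
have E := @derive_derive_dmap _ F p.
exact: (etrans (esym (E v w cp)) (etrans sw (E w v cp))).
Qed.

Implicit Types F G : S -> 'rV[R]_3.

Lemma smooth_in_dotv F G :
  smooth_in c F -> smooth_in c G ->
  smooth_in c (fun p => dotv (F p) (G p) : R^o).
Proof. exact: smooth_on_dotv. Qed.

Lemma smooth_in_crossv F G :
  smooth_in c F -> smooth_in c G -> smooth_in c (fun p => crossv (F p) (G p)).
Proof. exact: smooth_on_crossv. Qed.

Lemma dmap_dotv F G p v : smooth_in c F -> smooth_in c G -> dom c p ->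
  dmap c (fun q => dotv (F q) (G q) : R^o) p v =
  dotv (dmap c F p v) (G p) + dotv (F p) (dmap c G p v).
Proof.
move=> sF sG cp; have := derive_dotv v (smooth_in_differentiable sF cp)
  (smooth_in_differentiable sG cp).
by rewrite /= coordK.
Qed.

Lemma dmap_crossv F G p v : smooth_in c F -> smooth_in c G -> dom c p ->
  dmap c (fun q => crossv (F q) (G q)) p v =
  crossv (dmap c F p v) (G p) + crossv (F p) (dmap c G p v).
Proof.
move=> sF sG cp; have := derive_crossv v (smooth_in_differentiable sF cp)
  (smooth_in_differentiable sG cp).
by rewrite /= coordK.
Qed.

End ChartCalculus.

(** * Change of charts, and maps with vanishing differential *)

Section Surfaces.
Variables (R : realType) (S : surface R).

(** Chain rule: the expression of [f] in [c] is its expression in [c'] after the transition map.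
    They agree only where [param c] lands in [dom c'], which is a neighbourhood of the point by
    continuity. *)
Lemma dmap_transition (W : normedModType R) (f : S -> W) (c c' : chart R S)
    p v :
  atlas c -> atlas c' -> smooth_map f -> dom c p -> dom c' p ->
  dmap c f p v = dmap c' f p ('D_v (transition c c') (coord c p)).
Proof.
move=> Ac Ac' sf cp c'p; have Uu := coord_cod cp.
have tE : transition c c' (coord c p) = coord c' p.
  by rewrite /transition /= coordK.
have [st _] := atlas_compatible Ac Ac'.
rewrite /dmap -tE -derive_comp; last first.
- by rewrite tE; apply: smooth_in_differentiable c'p; exact: sf.
- by apply: smooth_on_differentiable st _; split=> //; rewrite coordK.
apply: near_eq_derive.
have nd : nbhs (param c (coord c p)) (dom c').
  by rewrite coordK//; exact: open_nbhs_nbhs (conj (@dom_open _ _ c') c'p).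
have : \forall u \near coord c p, dom c' (param c u).
  exact: (param_continuous Uu nd).
by apply: filterS => u c'u; rewrite /transition /= coordK.
Qed.

Lemma connected_locally_constant (F : S -> 'rV[R]_3) :
  connected [set: S] -> smooth_map F ->
  for_tangent (fun c p v => dmap c F p v = 0) -> exists a, forall p, F p = a.
Proof.
move=> S_conn sF dF.
have loc p : \forall q \near p, F q = F p.
  have [c Ac cp] := @atlas_covering _ S p.
  have Uu := coord_cod cp.
  have /nbhs_ballP[r /= r0 rU] : nbhs (coord c p) (cod c).
    exact: open_nbhs_nbhs (conj (@cod_open _ _ c) Uu).
  have cb : \forall q \near p, ball (coord c p) r (coord c q).
    by apply: (coord_continuous cp); exact: nbhsx_ballx.
  have cd : \forall q \near p, dom c q.
    exact: open_nbhs_nbhs (conj (@dom_open _ _ c) cp).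
  move: cb cd; apply: filterS2 => q qb cq.
  have := @constant_on_ball _ _ (F \o param c) (coord c p) r _ _ _ qb.
  rewrite /= !coordK//; apply.
  - by move=> y /rU Uy; exact: (smooth_on_differentiable (sF c Ac)).
  - move=> y v /rU Uy; have := dF c (param c y) v Ac (param_dom Uy).
    by rewrite /dmap paramK.
have [[p0 _]|S0] := pselect ([set: S] !=set0); last first.
  (* On the empty surface any value serves. *)
  by exists 0 => p; exfalso; apply: S0; exists p.
exists (F p0) => p.
suff E : [set q | F q = F p0] = setT.
  by have : [set: S] p by []; rewrite -E.
apply: S_conn.
- by exists p0.
- exists [set q | F q = F p0]; last by rewrite setTI.
  rewrite openE => q /= qp; rewrite /interior.
  apply: filterS (loc q) => r /= ->.
  exact: qp.
- exists [set q | F q = F p0]; last by rewrite setTI.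
  rewrite -openC openE => q /= qp; rewrite /interior.
  by apply: filterS (loc q) => r /= ->.
Qed.

End Surfaces.

(** * Immersions and their deformations *)

(* Keeps unification from unfolding directional derivatives. *)
Local Opaque derive dmap.

Section Immersions.
Variables (R : realType) (S : surface R).
Implicit Types (f F phi xi : S -> 'rV[R]_3) (c : chart R S) (p : S).

(** If the product vanished, expanding its product with the first partial derivative would give a
    linear relation. Injectivity forces the coefficient [b], the squared length of that derivative,
    to be 0, and the derivative itself would vanish. *)
Lemma immersion_crossv_neq0 f c p : immersion f -> atlas c -> dom c p ->
  crossv (dmap c f p e0) (dmap c f p e1) != 0.
Proof.
move=> [sf inj_f] Ac cp; have {}inj_f := inj_f c p Ac cp.
have f0 := @dmap0 _ _ c _ f p.
apply/eqP => n0.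
have := crossv_crossv (dmap c f p e0) (dmap c f p e0) (dmap c f p e1).
rewrite n0 (_ : crossv _ 0 = 0); last by apply: row3P; rewrite !coords3E; ring.
set a := dotv _ _; set b := dotv _ (dmap c f p e0).
rewrite -scaleNr -(dmap_comb a (- b) e0 e1 (sf c Ac) cp) -[X in X = _]f0.
move=> /inj_f /rowP /(_ 1).
rewrite !mxE /= mulr0 add0r mulr1 => /esym/eqP; rewrite oppr_eq0 dotvv_eq0.
rewrite -f0 => /eqP /inj_f /rowP /(_ 0); rewrite !mxE /= => /eqP.
by rewrite oner_eq0.
Qed.

Lemma smooth_in_deform f xi t c : smooth_in c f -> smooth_in c xi ->
  smooth_in c (deform f xi t).
Proof.
move=> sf sx; apply: smooth_inD => //.
apply: smooth_inZ => //; apply: smooth_in_cst.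
Qed.

Lemma dmap_deform f xi t c p v : smooth_in c f -> smooth_in c xi -> dom c p ->
  dmap c (deform f xi t) p v = dmap c f p v + t *: dmap c xi p v.
Proof.
move=> sf sx cp; rewrite -dmapZ// -dmapD//.
by apply: smooth_inZ => //; apply: smooth_in_cst.
Qed.

(* The normal of [F] is [phi] up to scaling, so that the second fundamental
   form of [F] is obtained by differentiating [dotv (dmap c F q v) (phi q) = 0].
   Both sides are 0 where [F] fails to be an immersion. *)
Lemma gauss_curvatureE F phi c p : smooth_in c F -> smooth_in c phi ->
  dom c p -> phi p != 0 ->
  (forall q v, dom c q -> dotv (dmap c F q v) (phi q) = 0) ->
  gauss_curvature c F p =
  dotv (phi p) (crossv (dmap c phi p e0) (dmap c phi p e1)) /
  (dotv (phi p) (phi p) *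
   dotv (crossv (dmap c F p e0) (dmap c F p e1)) (phi p)).
Proof.
move=> sF sphi cp phi0 Fphi.
have II v w : dotv (dmap c (fun q => dmap c F q w) p v) (phi p) =
    - dotv (dmap c F p w) (dmap c phi p v).
  apply/eqP; rewrite -addr_eq0 -dmap_dotv//; last exact: smooth_in_dmap.
  rewrite (@dmap_ext _ _ _ _ _ (fun=> 0))// ?dmap_cst//.
  by move=> q; exact: Fphi.
have secE i j : second_fundamental c F p i j =
    dotv (dmap c (fun q => dmap c F q (delta_mx 0 j)) p (delta_mx 0 i))
      (chart_normal c F p).
  by rewrite mxE (derive_coord_partialE F i j cp).
have fstE i j : first_fundamental c F p i j =
    dotv (dmap c F p (delta_mx 0 i)) (dmap c F p (delta_mx 0 j)).
  by rewrite mxE !coord_partialE.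
rewrite /gauss_curvature !det2E (fstE 0 0) (fstE 0 1) (fstE 1 0) (fstE 1 1).
rewrite (secE 0 0) (secE 0 1) (secE 1 0) (secE 1 1).
rewrite /chart_normal !coord_partialE.
exact: (curvature_algebra phi0 (Fphi p e0 cp) (Fphi p e1 cp)
  (II e0 e0) (II e0 e1) (II e1 e0) (II e1 e1)).
Qed.

End Immersions.

(** * Rotation and translation fields of isometric deformations *)

Section Isometric.
Variables (R : realType) (S : surface R).
Implicit Types (phi xi eta tau : S -> 'rV[R]_3) (c : chart R S) (p : S).

Lemma is_derive_induced_metric phi xi c p v w :
  smooth_in c phi -> smooth_in c xi -> dom c p ->
  is_derive (0 : R^o) (1 : R^o)
    (fun t : R^o => induced_metric (deform phi xi t) c p v w : R^o)
    (dotv (dmap c phi p v) (dmap c xi p w) +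
     dotv (dmap c xi p v) (dmap c phi p w)).
Proof.
move=> sp sx cp.
have -> : (fun t : R^o => induced_metric (deform phi xi t) c p v w : R^o) =
  (fun t : R^o => dotv (dmap c phi p v) (dmap c phi p w) +
    t * (dotv (dmap c phi p v) (dmap c xi p w) +
         dotv (dmap c xi p v) (dmap c phi p w)) +
    t * t * dotv (dmap c xi p v) (dmap c xi p w) : R^o).
  apply/funext => t; rewrite /induced_metric !dmap_deform//.
  move: (dmap c phi p v) (dmap c phi p w) (dmap c xi p v) (dmap c xi p w).
  by move=> a b d e; rewrite !coords3E; ring.
exact: is_derive_quadratic.
Qed.

(** Uniqueness of derivatives turns the condition on the metrics into a pointwise one: the
    differential of [xi] is skew relative to that of [phi]. *)
Lemma isometricP phi xi : smooth_map phi ->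
  isometric phi xi <-> smooth_map xi /\ (forall c p v w, atlas c -> dom c p ->
    dotv (dmap c phi p v) (dmap c xi p w) +
    dotv (dmap c xi p v) (dmap c phi p w) = 0).
Proof.
move=> sp; split=> -[sx dg].
  split=> // c p v w Ac cp; have dg' := dg c p v Ac cp w.
  have d := is_derive_induced_metric v w (sp c Ac) (sx c Ac) cp.
  rewrite -(@derive_val _ _ _ _ _ _ _ d); exact: derive_val.
split=> // c p v Ac cp w.
have := is_derive_induced_metric v w (sp c Ac) (sx c Ac) cp.
by rewrite (dg c p v w Ac cp).
Qed.

Lemma rotation_uniq phi c p a b : immersion phi -> atlas c -> dom c p ->
  (forall v, crossv a (dmap c phi p v) = crossv b (dmap c phi p v)) -> a = b.
Proof.
move=> iphi Ac cp E; have n0 := immersion_crossv_neq0 iphi Ac cp.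
exact: (crossv_inj2 n0 (E e0) (E e1)).
Qed.

(** Skewness on the coordinate vectors gives the hypotheses of [rotv_spec]; linearity extends the
    result to all [v]. *)
Lemma rotation_in_chart phi xi c p : immersion phi -> isometric phi xi ->
  atlas c -> dom c p ->
  forall v, dmap c xi p v =
    crossv (rotv (dmap c phi p e0) (dmap c phi p e1)
                 (dmap c xi p e0) (dmap c xi p e1)) (dmap c phi p v).
Proof.
move=> iphi isox Ac cp v; have [sp _] := iphi.
have [sx g0] := (isometricP xi sp).1 isox.
have n0 := immersion_crossv_neq0 iphi Ac cp.
have half (a b : 'rV[R]_3) : dotv a b + dotv b a = 0 -> dotv a b = 0 :> R.
  by rewrite (dotvC b) => ab; lra.
have h00 := half _ _ (g0 c p e0 e0 Ac cp).
have h11 := half _ _ (g0 c p e1 e1 Ac cp).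
have h01 := g0 c p e0 e1 Ac cp; rewrite (dotvC (dmap c xi p e0)) in h01.
have [r0 r1] := rotv_spec n0 h00 h11 h01.
rewrite (dmap_basis v (sx c Ac) cp) (dmap_basis v (sp c Ac) cp).
move: r0 r1; set r := rotv _ _ _ _ => r0 r1; clearbody r.
move: r0 r1.
move: (dmap c xi p e0) (dmap c xi p e1) (dmap c phi p e0) (dmap c phi p e1).
by move=> x0 x1 p0 p1 <- <-; apply: row3P; rewrite !coords3E; ring.
Qed.

(** The chartwise formulas glue: [rotation_uniq] makes [rot c p] independent of [c], so a chart may
    be chosen at each point and the field still agrees with the smooth [rot c] on all of [dom c]. *)
Lemma rotation_exists phi xi : immersion phi -> isometric phi xi ->
  exists2 eta, smooth_map eta & for_tangent (fun c p v =>
    dmap c xi p v = crossv (eta p) (dmap c phi p v)).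
Proof.
move=> iphi isox; have [sp _] := iphi; have [sx _] := isox.
have /choice[ch chP] (p : S) : exists c, atlas c /\ dom c p.
  by have [c] := @atlas_covering _ S p; exists c.
pose rot c p := rotv (dmap c phi p e0) (dmap c phi p e1)
                 (dmap c xi p e0) (dmap c xi p e1).
have rotE c c' p : atlas c -> atlas c' -> dom c p -> dom c' p ->
    rot c p = rot c' p.
  move=> Ac Ac' cp c'p; apply: (rotation_uniq iphi Ac cp) => v.
  have T := dmap_transition v Ac Ac' sp cp c'p.
  apply: etrans (esym (rotation_in_chart iphi isox Ac cp v)) _.
  apply: etrans (dmap_transition v Ac Ac' sx cp c'p) _.
  apply: etrans (rotation_in_chart iphi isox Ac' c'p _) _.
  exact: (congr1 (crossv (rot c' p)) (esym T)).
exists (fun p => rot (ch p) p).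
  move=> c Ac; apply: (@smooth_in_ext _ _ c _ (rot c)).
    by move=> p cp; have [Ad dp] := chP p; exact: rotE.
  have s0 := smooth_in_dmap e0 (sp c Ac).
  have s1 := smooth_in_dmap e1 (sp c Ac).
  have t0 := smooth_in_dmap e0 (sx c Ac).
  have t1 := smooth_in_dmap e1 (sx c Ac).
  have sn := smooth_in_crossv s0 s1.
  apply: smooth_inZ.
    apply: smooth_inV; last exact: smooth_in_dotv.
    by move=> p cp; rewrite dotvv_eq0; exact: immersion_crossv_neq0.
  apply: smooth_inD; first by apply: smooth_inZ => //; exact: smooth_in_dotv.
  apply: smooth_inD; first by apply: smooth_inZ => //; exact: smooth_in_dotv.
  by apply: smooth_inZ => //; apply: smooth_inN; exact: smooth_in_dotv.
move=> c p v Ac cp; have [Ad dp] := chP p.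
by rewrite (rotE _ _ _ Ad Ac dp cp); exact: rotation_in_chart.
Qed.

Lemma rotation_translation_exists phi xi : immersion phi -> isometric phi xi ->
  exists eta tau, rotation_translation phi xi eta tau.
Proof.
move=> iphi isox; have [sp _] := iphi; have [sx _] := isox.
have [eta se xe] := rotation_exists iphi isox.
(* This solves [xi = eta x phi + tau] for [tau]. In its differential [dxi] and [dphi x eta] cancel,
   which leaves [phi x deta]. *)
exists eta, (fun p => xi p + crossv (phi p) (eta p)).
have spe c : atlas c -> smooth_in c (fun p => crossv (phi p) (eta p)).
  by move=> Ac; apply: smooth_in_crossv; [exact: sp|exact: se].
split=> //.
- by move=> c Ac; apply: smooth_inD; [exact: sx|exact: spe].
- by move=> p; rewrite (crossvC (eta p)) addrC addrK.
- move=> c p v Ac cp.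
  rewrite (dmapD v (sx c Ac) (spe c Ac) cp).
  rewrite (dmap_crossv v (sp c Ac) (se c Ac) cp) xe// addrA.
  by rewrite (crossvC (eta p)) addNr add0r.
Qed.

Lemma translation_field_uniq phi xi tau tau' : immersion phi ->
  translation_field phi xi tau -> translation_field phi xi tau' -> tau = tau'.
Proof.
move=> iphi [eta [_ _ x1 d1 _]] [eta' [_ _ x2 d2 _]]; apply/funext => p.
have [c Ac cp] := @atlas_covering _ S p.
have E : eta p = eta' p.
  by apply: (rotation_uniq iphi Ac cp) => v; rewrite -d1// -d2.
by apply: (addrI (crossv (eta p) (phi p))); rewrite -x1 E -x2.
Qed.

(* This is the equality of the mixed partial derivatives of [xi]. *)
Lemma rotation_closed phi xi eta c p v w : smooth_map phi -> smooth_map xi ->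
  smooth_map eta -> for_tangent (fun c p v =>
    dmap c xi p v = crossv (eta p) (dmap c phi p v)) -> atlas c -> dom c p ->
  crossv (dmap c eta p v) (dmap c phi p w) =
  crossv (dmap c eta p w) (dmap c phi p v).
Proof.
move=> sp sx se xe Ac cp.
have D a b : dmap c (fun q => dmap c xi q b) p a =
    crossv (dmap c eta p a) (dmap c phi p b) +
    crossv (eta p) (dmap c (fun q => dmap c phi q b) p a).
  rewrite -(dmap_crossv a (se c Ac) (smooth_in_dmap b (sp c Ac)) cp).
  by apply: dmap_ext => // q cq; exact: xe.
have E : dmap c (fun q => dmap c xi q w) p v =
    dmap c (fun q => dmap c xi q v) p w.
  exact: (dmap_swap v w (sx c Ac) cp).
have E' : dmap c (fun q => dmap c phi q w) p v =
    dmap c (fun q => dmap c phi q v) p w.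
  exact: (dmap_swap v w (sp c Ac) cp).
by move: E; rewrite (D v w) (D w v) E' => /addIr.
Qed.

End Isometric.

(** * The polar dual *)

Section PolarDual.
Variables (R : realType) (S : surface R) (phi nu : S -> 'rV[R]_3).
Hypothesis phi_immersion : immersion phi.
Hypothesis nu_normal : unit_normal phi nu.
Hypothesis h_neq0 : forall p : S, support_function phi nu p <> 0.
Hypothesis psi_immersion : immersion (polar_dual phi nu).

Local Notation psi := (polar_dual phi nu).
Let phi_smooth : smooth_map phi := phi_immersion.1.
Let psi_smooth : smooth_map psi := psi_immersion.1.

Lemma dotv_polar_dual p : dotv (psi p) (phi p) = 1.
Proof. by rewrite dotvZl mulVf//; apply/eqP. Qed.

Lemma dotv_polar_dual_dmap c p v : atlas c -> dom c p ->
  dotv (psi p) (dmap c phi p v) = 0.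
Proof.
by move=> Ac cp; rewrite dotvZl; have [_ _ ->] := nu_normal; rewrite ?mulr0.
Qed.

Lemma dotv_dmap_polar_dual c p v : atlas c -> dom c p ->
  dotv (dmap c psi p v) (phi p) = 0.
Proof.
move=> Ac cp; have := dmap_dotv v (psi_smooth Ac) (phi_smooth Ac) cp.
rewrite (dotv_polar_dual_dmap v Ac cp) addr0 => <-.
rewrite (@dmap_ext _ _ _ _ _ (fun=> 1 : R^o))// ?dmap_cst//.
by move=> q _; exact: dotv_polar_dual.
Qed.

Lemma immersion_neq0 p : phi p != 0.
Proof.
apply/eqP => p0; have := dotv_polar_dual p; rewrite p0 => /eqP.
by rewrite !coords3E !mulr0 !addr0 eq_sym oner_eq0.
Qed.

(** [rotation_closed] on the two coordinate vectors feeds [crossv_eq_orthogonal], with [psi] as the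
    vector normal to [phi]. *)
Lemma dotv_dmap_rotation eta xi c p v : smooth_map eta -> smooth_map xi ->
  for_tangent (fun c p v => dmap c xi p v = crossv (eta p) (dmap c phi p v)) ->
  atlas c -> dom c p -> dotv (dmap c eta p v) (psi p) = 0.
Proof.
move=> se sx xe Ac cp; have n0 := immersion_crossv_neq0 phi_immersion Ac cp.
have C := rotation_closed e0 e1 phi_smooth sx se xe Ac cp.
have t v' := etrans (dotvC _ _) (dotv_polar_dual_dmap v' Ac cp).
have [d0 d1] := crossv_eq_orthogonal n0 C (t e0) (t e1).
by rewrite (dmap_basis v (se c Ac) cp); exact: (dotv_comb_eq0 _ _ d0 d1).
Qed.

(** As [phi] stays normal to [psi + t tau] for every [t], [gauss_curvatureE] applies at all times,
    even where the deformed map is no immersion. Only its denominator depends on [t]. *)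
Lemma is_derive_gauss_curvature tau c p : smooth_map tau ->
  (forall c p v, atlas c -> dom c p -> dotv (dmap c tau p v) (phi p) = 0) ->
  atlas c -> dom c p ->
  exists2 k : R, k != 0 & is_derive (0 : R^o) (1 : R^o)
    (fun t : R^o => gauss_curvature c (deform psi tau t) p : R^o)
    (k * dotv (crossv (dmap c tau p e0) (dmap c psi p e1) +
               crossv (dmap c psi p e0) (dmap c tau p e1)) (phi p)).
Proof.
move=> st tphi Ac cp; have sp := psi_smooth Ac; have stc := st c Ac.
have n0 := immersion_crossv_neq0 phi_immersion Ac cp.
have m0 := immersion_crossv_neq0 psi_immersion Ac cp.
have P0 : dotv (phi p) (phi p) != 0 by rewrite dotvv_eq0 immersion_neq0.
have l0 := crossv_neq0 m0 (dotv_dmap_polar_dual e0 Ac cp)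
  (dotv_dmap_polar_dual e1 Ac cp) (immersion_neq0 p).
(* Otherwise [psi], a multiple of this cross product, would be orthogonal to [phi], against
   [dotv_polar_dual]. *)
have C0 : dotv (phi p) (crossv (dmap c phi p e0) (dmap c phi p e1)) != 0.
  have t v' := etrans (dotvC _ _) (dotv_polar_dual_dmap v' Ac cp).
  apply/eqP => pn; have := dotv_polar_dual p.
  rewrite (orthogonal_collinear n0 (t e0) (t e1)) dotvZl
    (dotvC (crossv _ _) (phi p)) pn mulr0.
  by move/eqP; rewrite eq_sym oner_eq0.
have KE : (fun t : R^o => gauss_curvature c (deform psi tau t) p : R^o) =
  (fun t : R^o => dotv (phi p) (crossv (dmap c phi p e0) (dmap c phi p e1)) /
    (dotv (phi p) (phi p) *
      (dotv (crossv (dmap c psi p e0) (dmap c psi p e1)) (phi p) +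
       t * dotv (crossv (dmap c tau p e0) (dmap c psi p e1) +
               crossv (dmap c psi p e0) (dmap c tau p e1)) (phi p) +
       t * t * dotv (crossv (dmap c tau p e0) (dmap c tau p e1)) (phi p)))).
  apply/funext => t.
  rewrite (gauss_curvatureE (smooth_in_deform t sp stc) (phi_smooth Ac) cp
    (immersion_neq0 p)); last first.
    move=> q v cq; rewrite (dmap_deform t v sp stc cq) dotvDl dotvZl.
    by rewrite dotv_dmap_polar_dual// tphi// mulr0 addr0.
  rewrite (dmap_deform t e0 sp stc cp) (dmap_deform t e1 sp stc cp).
  congr (_ / (_ * _)).
  move: (dmap c psi p e0) (dmap c psi p e1) (dmap c tau p e0) (dmap c tau p e1).
  by move=> a b d e; rewrite !coords3E; ring.
rewrite KE; move: C0 P0 l0.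
set C := dotv (phi p) (crossv _ _); set P := dotv (phi p) (phi p).
set L := dotv _ _; set L1 := dotv _ _; set L2 := dotv _ _ => C0 P0 l0.
(* The derivative of [C / (P * x)] with respect to [x] at [x = L]. *)
exists (- (C / P / L ^+ 2)).
  by rewrite oppr_eq0 !mulf_neq0// ?invr_eq0// expf_neq0.
have := is_derive_inv_quadratic C L1 L2 P0 l0.
by rewrite (_ : - (C / P * L1 / L ^+ 2) = - (C / P / L ^+ 2) * L1)//; ring.
Qed.

(** The image of the differential of [psi] is the plane orthogonal to [phi], and the nonzero factor
    [k] can be cancelled from the derivative of the curvature. *)
Lemma isogaussP tau : isogauss psi tau <->
  [/\ smooth_map tau,
      forall c p v, atlas c -> dom c p -> dotv (dmap c tau p v) (phi p) = 0 &
      forall c p, atlas c -> dom c p ->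
        dotv (crossv (dmap c tau p e0) (dmap c psi p e1) +
              crossv (dmap c psi p e0) (dmap c tau p e1)) (phi p) = 0].
Proof.
split=> [[st rt dK]|[st tphi vt]].
  have tphi c p v : atlas c -> dom c p -> dotv (dmap c tau p v) (phi p) = 0.
    move=> Ac cp; have [] := rt c p Ac cp (dmap c tau p v); first by exists v.
    by move=> v' _ <-; exact: dotv_dmap_polar_dual.
  split=> // c p Ac cp.
  have [k k0 d] := is_derive_gauss_curvature st tphi Ac cp.
  have d0 := dK c p Ac cp.
  have /eqP := etrans (esym (@derive_val _ _ _ _ _ _ _ d))
    (@derive_val _ _ _ _ _ _ _ d0).
  by rewrite mulf_eq0 (negbTE k0) => /eqP.
split=> // c p Ac cp; last first.
  have [k k0 d] := is_derive_gauss_curvature st tphi Ac cp.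
  by rewrite vt// mulr0 in d.
move=> _ [v _ <-].
have [a [b ->]] := orthogonal_span (immersion_crossv_neq0 psi_immersion Ac cp)
  (immersion_neq0 p) (dotv_dmap_polar_dual e0 Ac cp)
  (dotv_dmap_polar_dual e1 Ac cp) (tphi c p v Ac cp).
exists (a *: e0 + b *: e1) => //.
exact: (dmap_comb a b e0 e1 (psi_smooth Ac) cp).
Qed.

Lemma translation_field_isogauss xi tau : smooth_map xi ->
  translation_field phi xi tau -> isogauss psi tau.
Proof.
move=> sx [eta [se st xE xe te]]; apply/isogaussP; split=> //.
  by move=> c p v Ac cp; rewrite te// !coords3E; ring.
move=> c p Ac cp; rewrite (te c p e0 Ac cp) (te c p e1 Ac cp).
apply: (dotv_crossv_variation (dotv_dmap_polar_dual e0 Ac cp)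
  (dotv_dmap_polar_dual e1 Ac cp)).
(* Derivative of the orthogonality of [deta] and [psi]. Symmetry of the second derivatives of [eta]
   then makes the right side symmetric in [v] and [w]. *)
have D v w : dotv (dmap c (fun q => dmap c eta q v) p w) (psi p) =
    - dotv (dmap c eta p v) (dmap c psi p w).
  apply/eqP; rewrite -addr_eq0.
  rewrite -(dmap_dotv w (smooth_in_dmap v (se c Ac)) (psi_smooth Ac) cp).
  rewrite (@dmap_ext _ _ _ _ _ (fun=> 0))// ?dmap_cst//.
  by move=> q cq; exact: (dotv_dmap_rotation v se sx xe Ac cq).
apply: oppr_inj; apply: etrans (esym (D e0 e1)) _.
apply: etrans _ (D e1 e0).
exact: (congr1 (fun z => dotv z (psi p)) (dmap_swap e1 e0 (se c Ac) cp)).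
Qed.

(** A Killing field with parameters [a] and [b] has rotation field [a] by [rotation_uniq], hence
    translation field [b]. Conversely, a constant [tau] forces [deta = 0], and connectedness makes
    [eta] constant. *)
Lemma killing_translation xi tau : connected [set: S] -> smooth_map xi ->
  translation_field phi xi tau ->
  induced_by_killing phi xi <-> constant_field tau.
Proof.
move=> S_conn sx [eta [se st xE xe te]]; split=> [[a [b xab]]|[b tb]].
  exists b => p; have [c Ac cp] := @atlas_covering _ S p.
  suff ea : eta p = a.
    by apply: (addrI (crossv (eta p) (phi p))); rewrite -xE xab ea.
  apply: (rotation_uniq phi_immersion Ac cp) => v; rewrite -xe//.
  have scst d : smooth_in c (fun=> d : 'rV[R]_3) by exact: smooth_in_cst.
  rewrite (@dmap_ext _ _ c _ xi (fun q => crossv a (phi q) + b))//.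
  rewrite (dmapD v (smooth_in_crossv (scst a) (phi_smooth Ac)) (scst b) cp).
  rewrite (dmap_crossv v (scst a) (phi_smooth Ac) cp) !dmap_cst addr0.
  by apply: row3P; rewrite !coords3E; ring.
have [a ea] : exists a, forall p, eta p = a.
  apply: connected_locally_constant => // c p v Ac cp.
  have t0 : crossv (phi p) (dmap c eta p v) = 0.
    rewrite -te//; have -> : tau = (fun=> b) by apply/funext.
    exact: dmap_cst.
  (* The product of [psi] with [phi x deta] is [- deta], since [psi] is orthogonal to [deta] and has
     product 1 with [phi]. *)
  have := crossv_crossv (psi p) (phi p) (dmap c eta p v).
  rewrite t0 dotv_polar_dual dotvC (dotv_dmap_rotation v se sx xe Ac cp).
  rewrite scale0r sub0r scale1r => E; apply: oppr_inj; rewrite -E.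
  by apply: row3P; rewrite !coords3E; ring.
by exists a, b => p; rewrite xE ea tb.
Qed.

(** [H1_trivial] is applied to each of the three components of the vector-valued form [dtau x psi];
    the primitives are the entries of [eta]. *)
Lemma isogauss_potential tau : isogauss psi tau -> H1_trivial S ->
  exists2 eta, smooth_map eta & for_tangent (fun c p v =>
    dmap c eta p v = crossv (dmap c tau p v) (psi p)).
Proof.
move=> /isogaussP[st tphi vt] H1.
pose w (k : 'I_3) (c : chart R S) (p : S) : 'rV[R]_2 :=
  \row_j crossv (dmap c tau p (delta_mx 0 j)) (psi p) 0 k.
have wE k c p v : atlas c -> dom c p ->
    dotv (w k c p) v = crossv (dmap c tau p v) (psi p) 0 k.
  by move=> Ac cp; rewrite (dmap_basis v (st c Ac) cp); exact: dotv_row_crossv.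
have sc c v : atlas c -> smooth_in c (fun p => crossv (dmap c tau p v) (psi p)).
  by move=> Ac; apply: smooth_in_crossv (psi_smooth Ac);
    exact/smooth_in_dmap/st.
have sw k c : atlas c -> smooth_in c (w k c).
  move=> Ac; apply/smooth_in_rowP => j.
  apply: (@smooth_in_ext _ _ _ _
    (fun p => crossv (dmap c tau p (delta_mx 0 j)) (psi p) 0 k : R^o)).
    by move=> p cp; rewrite [RHS]mxE.
  by have /smooth_in_rowP := sc c (delta_mx 0 j) Ac; exact.
have w1 k : one_form (w k).
  split=> [c Ac|c c' p v Ac Ac' cp c'p]; first exact: sw.
  apply: etrans (wE k c p v Ac cp) _.
  apply: etrans _ (esym (wE k c' p _ Ac' c'p)).
  exact: (congr1 (fun z => crossv z (psi p) 0 k)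
    (dmap_transition v Ac Ac' st cp c'p)).
have Dw k c p j v : atlas c -> dom c p -> dmap c (w k c) p v 0 j =
    (crossv (dmap c (fun q => dmap c tau q (delta_mx 0 j)) p v) (psi p) +
     crossv (dmap c tau p (delta_mx 0 j)) (dmap c psi p v)) 0 k.
  move=> Ac cp; rewrite (dmap_row v j (sw k c Ac) cp).
  rewrite -(dmap_crossv v (smooth_in_dmap _ (st c Ac)) (psi_smooth Ac) cp).
  rewrite (dmap_row v k (sc c (delta_mx 0 j) Ac) cp).
  by apply: dmap_ext => // q cq; rewrite [LHS]mxE.
(* The second derivatives of [tau] match by symmetry, and the remaining products [tau_0 x psi_1] and
   [tau_1 x psi_0] agree by [crossv_add_eq0]. *)
have w2 k : closed_form (w k).
  move=> c p Ac cp; have E := dmap_swap e0 e1 (st c Ac) cp.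
  have E' := crossv_add_eq0 (immersion_neq0 p) (tphi c p e0 Ac cp)
    (tphi c p e1 Ac cp) (dotv_dmap_polar_dual e0 Ac cp)
    (dotv_dmap_polar_dual e1 Ac cp) (vt c p Ac cp).
  apply: etrans (Dw k c p 1 e0 Ac cp) _.
  apply: etrans _ (esym (Dw k c p 0 e1 Ac cp)).
  exact: (congr1 (fun z : 'rV[R]_3 => z 0 k)
    (congr2 +%R (congr1 (fun z => crossv z (psi p)) E) (esym E'))).
have /choice[f fP] k : exists f : S -> R^o, smooth_map f /\
    for_tangent (fun c p v => dmap c f p v = dotv (w k c p) v).
  by have [f] := H1 _ (w1 k) (w2 k); exists f.
have se : smooth_map (fun p => \row_k f k p : 'rV[R]_3).
  move=> c Ac; apply/(smooth_in_rowP c) => k.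
  apply: (@smooth_in_ext _ _ _ _ (f k)); first by move=> p _; rewrite mxE.
  exact: (fP k).1.
exists (fun p => \row_k f k p) => // c p v Ac cp; apply/rowP => k.
rewrite (dmap_row v k (se c Ac) cp) -wE// -(fP k).2//.
by apply: dmap_ext => // q _; rewrite mxE.
Qed.

Lemma isogauss_isometric tau : isogauss psi tau -> H1_trivial S ->
  exists2 xi, isometric phi xi & translation_field phi xi tau.
Proof.
move=> it H1; have [eta se ee] := isogauss_potential it H1.
have /isogaussP[st tphi _] := it.
pose xi p := crossv (eta p) (phi p) + tau p.
have sep c : atlas c -> smooth_in c (fun p => crossv (eta p) (phi p)).
  by move=> Ac; apply: smooth_in_crossv (phi_smooth Ac); exact: se.
have sx : smooth_map xi.
  by move=> c Ac; apply: smooth_inD; [exact: sep|exact: st].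
(* The product of [phi] with [dtau x psi] has a [dtau] term with factor 1 and a [psi] term with
   factor 0. *)
have te c p v : atlas c -> dom c p ->
    crossv (phi p) (dmap c eta p v) = dmap c tau p v.
  move=> Ac cp; rewrite ee// crossv_crossv (dotvC _ (psi p)) dotv_polar_dual.
  by rewrite (dotvC (phi p)) tphi// scale1r scale0r subr0.
have xe : for_tangent (fun c p v =>
    dmap c xi p v = crossv (eta p) (dmap c phi p v)).
  move=> c p v Ac cp; rewrite (dmapD v (sep c Ac) (st c Ac) cp).
  rewrite (dmap_crossv v (se c Ac) (phi_smooth Ac) cp) -(te c p v Ac cp).
  by rewrite (crossvC (phi p)) addrAC subrr add0r.
exists xi; last first.
  by exists eta; split=> // c p v Ac cp; rewrite te.
(* The cross product with the fixed vector [eta p] is skew, so the two terms cancel. *)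
apply/(isometricP xi phi_smooth); split=> // c p v w Ac cp.
rewrite (xe c p v Ac cp) (xe c p w Ac cp).
by move: (dmap c phi p v) (dmap c phi p w) => a b; rewrite !coords3E; ring.
Qed.

End PolarDual.

(** * The correspondence between isometric and isogauss deformations *)

Theorem lemma5p5 (R : realType) (S : surface R)
    (S_connected : connected [set: S]) (S_orientable : orientable S)
    (phi nu : S -> 'rV[R]_3)
    (phi_immersion : immersion phi)
    (nu_normal : unit_normal phi nu)
    (h_neq0 : forall p : S, support_function phi nu p <> 0)
    (psi_immersion : immersion (polar_dual phi nu)) :
  (forall xi : S -> 'rV[R]_3, isometric phi xi ->
     exists tau : S -> 'rV[R]_3,
       [/\ unique (translation_field phi xi) tau,
           isogauss (polar_dual phi nu) tau &
           induced_by_killing phi xi <-> constant_field tau]) /\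
  (forall tau : S -> 'rV[R]_3, isogauss (polar_dual phi nu) tau ->
     H1_trivial S ->
     exists xi : S -> 'rV[R]_3,
       [/\ isometric phi xi,
           translation_field phi xi tau &
           induced_by_killing phi xi <-> constant_field tau]).
Proof.
split=> [xi isox|tau isot H1].
  have [sx _] := isox.
  have [eta [tau rt]] := rotation_translation_exists phi_immersion isox.
  have tt : translation_field phi xi tau by exists eta.
  exists tau; split.
  - by split=> // tau' tt';
      exact: (translation_field_uniq phi_immersion tt tt').
  - exact: (translation_field_isogauss phi_immersion nu_normal h_neq0
      psi_immersion sx tt).
  - exact: (killing_translation phi_immersion nu_normal h_neq0 S_connected
      sx tt).
have [xi isox tt] := isogauss_isometric phi_immersion nu_normal h_neq0
  psi_immersion isot H1.
exists xi; split=> //.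
exact: (killing_translation phi_immersion nu_normal h_neq0 S_connected
  isox.1 tt).
Qed.
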